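(* $\mathrm{Tr}$ is a functor from the category of discretely valued hyperfields which are not fields (with morphisms of valued hyperfields) to the category of triples; in particular, for morphisms $f:H\to H'$ and $f':H'\to H''$ with $\mathrm{Tr}(f)=(r,\phi,\eta)$ and $\mathrm{Tr}(f')=(r',\phi',\eta')$, one has $\mathrm{Tr}(f'\circ f)=(rr',\phi'\phi,\eta'^{\otimes r}\eta)$.
   Context: A hyperfield is a set $H$ with a multivalued addition $+:H\times H\to 2^H$ and a single-valued multiplication such that: $(x+y)+z=x+(y+z)$ for all $x,y,z$, where $(x+y)+z:=\bigcup_{t\in x+y}(t+z)$ and similarly on the right; $x+y=y+x$; there is $0\in H$ with $x+0=\{x\}$ for all $x$; for every $x$ there is a unique $-x$ with $0\in x+(-x)$; $x\in y-z$ iff $y\in x+z$ (where $y-z:=y+(-z)$); multiplication is commutative, associative, unital, with $(x+y)z\subseteq xz+yz$; $0\neq 1$ and every nonzero element is invertible. For subsets, $A+B=\bigcup_{a\in A,b\in B}(a+b)$. A hyperfield ''is a field'' if all its sums are singletons. A valued hyperfield is a hyperfield with a map $|\cdot|:H\to\mathbb{R}$ such that (i) $|x|\ge0$ with equality iff $x=0$; (ii) $|xy|=|x||y|$; (iii) $|z|\le\max(|x|,|y|)$ for all $z\in x+y$; (iv) $|\cdot|$ is constant on $x+y$ unless $0\in x+y$ (this gives a metric $d(x,y)=|z|$ for any $z\in x-y$ when $x\neq y$, $d(x,x)=0$); (v) there is a real $\rho>0$ such that either $x+y$ is a closed ball of radius $\rho\max(|x|,|y|)$ for all $x,y$, or $x+y$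 is an open ball of radius $\rho\max(|x|,|y|)$ for all $x,y$; the smallest such $\rho$ is denoted $\rho_H$. $H$ is discretely valued if $0$ is the only non-isolated point of $\{|x|:x\in H\}$. A morphism of valued hyperfields $f:H_1\to H_2$ is a map with $f(xy)=f(x)f(y)$, $f^{-1}(a+b)=f^{-1}(a)+f^{-1}(b)$ for all $a,b\in f(H_1)$, $|f(x)|=|x|$, and $f^{-1}(1)$ a ball. For $H$ discretely valued and not a field: $\theta_H$ is the smallest element of $\{|x|:x\neq0\}$ less than $1$; a uniformizer is $\pi$ with $|\pi|=\theta_H$; $\mathcal{O}_H$ is the closed ball of radius $1$ about $0$ and $\mathfrak{m}_H^k$ the closed ball of radius $\theta_H^k$ about $0$. Triples: a truncated DVR is a local Artinian ring $R$ whose maximal ideal $\mathfrak{m}_R$ is principal. A triple $(R,M,\epsilon)$ is a truncated DVR $R$, a free $R$-module $M$ of rank $1$, and an $R$-linear $\epsilon:M\to R$ with image $\mathfrak{m}_R$. For integers $s\ge r$, $\epsilon_{r,s}:M^{\otimes s}\to M^{\otimes r}$ is the $R$-linear map with $x^{\otimes s}\mapsto\epsilon(x)^{s-r}x^{\otimes r}$ for a generator $x$. A morphism $(r,f,\eta):(R,M,\epsilon)\to(R',M',\epsilon')$ is a ring homomorphism $f:R\to R'$, an integer $r$, and an $R$-linear $\eta:M\to M'^{\otimes r}$ with $f\circ\epsilon=\epsilon'_{0,r}\circ\eta$ and such that the induced map $M\otimes_RR'\to M'^{\otimes r}$ is an isomorphism; composition is $(r,f,\eta)\circ(s,g,\theta)=(rs,fg,\eta^{\otimes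 s}\theta)$. Construction: for $H$ and $i\in\mathbb{Z}$, let $M_i=\mathfrak{m}_H^i/\!\sim$ where $x\sim y$ iff $d(x,y)\le\rho_H\theta_H^i$; the sum of classes of $\hat x,\hat y$ is the class of any element of $\hat x+\hat y$, and products of lifts give $M_i\times M_j\to M_{i+j}$. Put $R=M_0$, $M=M_1$; for a uniformizer $\pi$, $M_i$ is identified with $M^{\otimes i}$ by sending the class of $\pi^i$ to $\bar\pi^{\otimes i}$. $\epsilon:M\to R$ sends the class of $\hat x\in\mathfrak{m}_H$ to the class of $\hat x$ in $R$. $\mathrm{Tr}(H)=(R,M,\epsilon)$. For a morphism $f:H\to H'$, $\mathrm{Tr}(f)=(r,\phi,\eta)$ where $r=\log\theta_H/\log\theta_{H'}$, $\phi:R\to R'$ sends the class of $\hat x\in\mathcal{O}_H$ to the class of $f(\hat x)$, and $\eta:M\to M'^{\otimes r}\cong M'_r$ sends the class of $\hat x\in\mathfrak{m}_H$ to the class of $f(\hat x)\in\mathfrak{m}_{H'}^r$.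
   Formalization: θ_H is taken as the largest (not smallest) value |x| less than 1, since no smallest nonzero value exists; the open-ball axiom omits x=y=0, where 0+0={0} but the open ball of radius 0 is empty; degrees r of morphisms of triples are r≥0, where ε'_{0,r} is defined. *)

(* Defs.v *)
From HB Require Import structures.
From mathcomp Require Import all_boot all_order all_algebra.
From mathcomp Require Import generic_quotient.
From mathcomp Require Import all_classical all_reals all_analysis.

Set Implicit Arguments.
Unset Strict Implicit.
Unset Printing Implicit Defensive.

Import Order.TTheory GRing.Theory Num.Theory.
Import numFieldNormedType.Exports.
Local Open Scope classical_set_scope.
Local Open Scope quotient_scope.
Local Open Scope ring_scope.

Record hyperfield := Hyperfield {
  hf_sort :> choiceType;
  hadd : hf_sort -> hf_sort -> set hf_sort;
  hmul : hf_sort -> hf_sort -> hf_sort;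
  hopp : hf_sort -> hf_sort;
  hzero : hf_sort;
  hone : hf_sort;
  haddA : forall x y z,
    \bigcup_(t in hadd x y) hadd t z = \bigcup_(t in hadd y z) hadd x t;
  haddC : forall x y, hadd x y = hadd y x;
  hadd0 : forall x, hadd x hzero = [set x];
  hadd_opp : forall x y, hadd x y hzero <-> y = hopp x;
  hadd_rev : forall x y z, hadd y (hopp z) x <-> hadd x z y;
  hmulC : forall x y, hmul x y = hmul y x;
  hmulA : forall x y z, hmul x (hmul y z) = hmul (hmul x y) z;
  hmul1 : forall x, hmul x hone = x;
  hmulD : forall x y z,
    [set hmul t z | t in hadd x y] `<=` hadd (hmul x z) (hmul y z);
  hone_neq0 : hzero <> hone;
  hmul_inv : forall x, x <> hzero -> exists y, hmul x y = hone }.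

Arguments hzero {h}.
Arguments hone {h}.

Local Notation "x [+] y" := (hadd x y) (at level 50, left associativity).
Local Notation "x [-] y" := (hadd x (hopp y)) (at level 50, left associativity).
Local Notation "x [*] y" := (hmul x y) (at level 40, left associativity).

Definition hadds (H : hyperfield) (A B : set H) : set H :=
  \bigcup_(a in A) \bigcup_(b in B) (a [+] b).

Definition is_field (H : hyperfield) : Prop :=
  forall x y : H, exists z, x [+] y = [set z].

Section Metric.
Context (K : realType) (H : hyperfield) (nm : H -> K).

(* For [x != y] the valuation is constant on [x - y], so that the choice made
   by [xget] is immaterial. *)
Definition dist_of (x y : H) : K :=
  if x == y then 0 else xget 0 [set nm z | z in x [-] y].

Definition closed_ball_of (c : H) (r : K) : set H := [set y | dist_of c y <= r].
Definition open_ball_of (c : H) (r : K) : set H := [set y | dist_of c y < r].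

(* In the open case [x = y = 0] is left out: [0 + 0 = {0}], whereas the open
   ball of radius 0 is empty. *)
Definition sums_are_balls (rho : K) : Prop :=
  (forall x y : H, exists c,
     x [+] y = closed_ball_of c (rho * Num.max (nm x) (nm y))) \/
  (forall x y : H, 0 < Num.max (nm x) (nm y) -> exists c,
     x [+] y = open_ball_of c (rho * Num.max (nm x) (nm y))).

End Metric.

Record valued_hyperfield (K : realType) := ValuedHyperfield {
  vh_base :> hyperfield;
  hnorm : vh_base -> K;
  hnorm_ge0 : forall x, 0 <= hnorm x;
  hnorm_eq0 : forall x, hnorm x = 0 <-> x = hzero;
  hnormM : forall x y, hnorm (x [*] y) = hnorm x * hnorm y;
  hnormD : forall x y z, (x [+] y) z -> hnorm z <= Num.max (hnorm x) (hnorm y);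
  hnorm_const : forall x y, ~ (x [+] y) hzero ->
    forall z z', (x [+] y) z -> (x [+] y) z' -> hnorm z = hnorm z';
  hnorm_ball : exists2 rho, 0 < rho & sums_are_balls hnorm rho }.

Section Valued.
Context (K : realType) (H : valued_hyperfield K).

Definition hdist : H -> H -> K := dist_of (@hnorm K H).
Definition closed_hball : H -> K -> set H := closed_ball_of (@hnorm K H).
Definition open_hball : H -> K -> set H := open_ball_of (@hnorm K H).

Definition is_hball (S : set H) : Prop :=
  exists c r, S = closed_hball c r \/ S = open_hball c r.

(* The infimum is attained when [H] is discretely valued. *)
Definition rho : K := inf [set r | 0 < r /\ sums_are_balls (@hnorm K H) r].

Definition discretely_valued : Prop :=
  forall v, range (@hnorm K H) v -> (~ isolated (range (@hnorm K H)) v <-> v = 0).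

(* The largest value less than 1: a smallest nonzero one cannot exist, as 0 is
   a limit of values. The supremum is attained when [H] is discretely valued. *)
Definition theta : K := sup [set hnorm x | x in [set x : H | x <> hzero /\ hnorm x < 1]].

Definition uniformizer (p : H) : Prop := hnorm p = theta.

End Valued.

Arguments rho {K} H.
Arguments theta {K} H.

Record dv_hyperfield (K : realType) := DVHyperfield {
  dv_base :> valued_hyperfield K;
  dv_discrete : discretely_valued dv_base;
  dv_not_field : ~ is_field dv_base }.

Section HyperfieldTheory.
Context (H : hyperfield).
Implicit Types x y z : H.

Lemma haddCE x y z : (x [+] y) z -> (y [+] x) z.
Proof. by rewrite haddC. Qed.

Lemma haddAE x y z t u : (x [+] y) t -> (t [+] z) u ->
  exists2 s, (y [+] z) s & (x [+] s) u.
Proof.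
move=> xyt tzu; have : (\bigcup_(t in x [+] y) (t [+] z)) u by exists t.
by rewrite haddA => -[s ? ?]; exists s.
Qed.

Lemma haddAE' x y z t u : (y [+] z) t -> (x [+] t) u ->
  exists2 s, (x [+] y) s & (s [+] z) u.
Proof.
move=> xyt tzu; have : (\bigcup_(t in y [+] z) (x [+] t)) u by exists t.
by rewrite -haddA => -[s ? ?]; exists s.
Qed.

Lemma haddxN x : (x [-] x) hzero. Proof. exact/hadd_opp. Qed.

Lemma hoppK x : hopp (hopp x) = x.
Proof. by symmetry; apply/hadd_opp/haddCE/haddxN. Qed.

Lemma hadd_ne x y : exists z, (x [+] y) z.
Proof.
have h0 : (x [+] hzero) x by rewrite hadd0.
by have [s xys _] := haddAE' (haddxN y) h0; exists s.
Qed.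

Lemma hsub0 x y : (x [-] y) hzero <-> x = y.
Proof.
split=> [|->]; last exact: haddxN.
by move/hadd_opp => /(congr1 (@hopp H)); rewrite !hoppK.
Qed.

Lemma haddACA x y x' y' z v w : (x [+] y) z -> (x' [+] y') v -> (z [+] v) w ->
  exists a b, [/\ (x [+] x') a, (y [+] y') b & (a [+] b) w].
Proof.
move=> xyz xyv zvw.
have [s yvs xsw] := haddAE xyz zvw.
have [p yxp pys] := haddAE' xyv yvs.
have [b yyb xbs] := haddAE (haddCE yxp) pys.
have [a xxa abw] := haddAE' xbs xsw.
by exists a, b.
Qed.

Lemma hmulDE x y z t : (x [+] y) t -> (x [*] z [+] y [*] z) (t [*] z).
Proof. by move=> xyt; apply: hmulD; exists t. Qed.

End HyperfieldTheory.

Section ValuedTheory.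
Context (K : realType) (H : valued_hyperfield K).
Implicit Types x y z : H.

Lemma hnorm0 : hnorm (hzero : H) = 0. Proof. exact/hnorm_eq0. Qed.

Lemma hnorm_gt0 x : x <> hzero -> 0 < hnorm x.
Proof. by move=> x0; rewrite lt_def hnorm_ge0 andbT; apply/eqP => /hnorm_eq0. Qed.

Lemma hnorm1 : hnorm (hone : H) = 1.
Proof.
have n0 : hnorm (hone : H) != 0 by apply/eqP => /hnorm_eq0/esym/(@hone_neq0 H).
by apply: (mulfI n0); rewrite -hnormM hmul1 mulr1.
Qed.

Lemma hmul0 x : hzero [*] x = hzero.
Proof. by apply/hnorm_eq0; rewrite hnormM hnorm0 mul0r. Qed.

Lemma hoppE x : hopp x = hopp hone [*] x.
Proof.
symmetry; apply/hadd_opp.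
by have := hmulDE x (haddxN (hone : H)); rewrite hmul0 hmulC hmul1.
Qed.

Lemma hmulN x y : hopp x [*] y = hopp (x [*] y).
Proof. by rewrite (hoppE x) -hmulA -hoppE. Qed.

Lemma hnormN x : hnorm (hopp x) = hnorm x.
Proof.
rewrite hoppE hnormM; have : hnorm (hopp hone : H) ^+ 2 = 1.
  by rewrite expr2 -hnormM -hoppE hoppK hnorm1.
move/eqP; rewrite sqrf_eq1 => /orP[/eqP ->|/eqP N1]; first by rewrite mul1r.
by have := hnorm_ge0 (hopp hone : H); rewrite N1 oppr_ge0 ler10.
Qed.

Lemma haddN x y z : (x [+] y) z -> (hopp x [+] hopp y) (hopp z).
Proof.
by move/(hmulDE (hopp hone)); rewrite !(hmulC _ (hopp hone)) -!hoppE.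
Qed.

Lemma hopp0 : hopp hzero = hzero :> H.
Proof. by apply/hnorm_eq0; rewrite hnormN hnorm0. Qed.

Lemma hsubx0 x z : (x [-] hzero) z -> z = x.
Proof. by rewrite hopp0 hadd0. Qed.

Lemma hsubC x y z : (x [-] y) z -> (y [-] x) (hopp z).
Proof. by move/haddN; rewrite hoppK => /haddCE. Qed.

Lemma hdistxx x : hdist x x = 0. Proof. by rewrite /hdist /dist_of eqxx. Qed.

Lemma hdistE x y z : x <> y -> (x [-] y) z -> hdist x y = hnorm z.
Proof.
move=> xy xyz; rewrite /hdist /dist_of; case: eqP => // _.
case: xgetP => [_ _ [u xyu <-]|/(_ (hnorm z))]; last by case; exists z.
by apply: hnorm_const xyu xyz => /hsub0.
Qed.

Lemma hdist_le x y z : (x [-] y) z -> hdist x y <= hnorm z.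
Proof.
move=> xyz; have [->|/eqP xy] := eqVneq x y; first by rewrite hdistxx hnorm_ge0.
by rewrite (hdistE xy xyz).
Qed.

Lemma hdist_ge0 x y : 0 <= hdist x y.
Proof.
have [->|/eqP xy] := eqVneq x y; first by rewrite hdistxx.
by have [z xyz] := hadd_ne x (hopp y); rewrite (hdistE xy xyz) hnorm_ge0.
Qed.

Lemma hdist_eq0 x y : hdist x y <= 0 -> x = y.
Proof.
have [->//|/eqP xy] := eqVneq x y.
have [z xyz] := hadd_ne x (hopp y); rewrite (hdistE xy xyz) => z0.
have /hnorm_eq0 z0' : hnorm z = 0 by apply/eqP; rewrite eq_le z0 hnorm_ge0.
by apply/hsub0; rewrite -z0'.
Qed.

Lemma hdistC x y : hdist x y = hdist y x.
Proof.
have [->//|/eqP xy] := eqVneq x y.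
have [z xyz] := hadd_ne x (hopp y).
by rewrite (hdistE xy xyz) (hdistE _ (hsubC xyz)) ?hnormN// => /esym.
Qed.

Lemma hdist0 x : hdist hzero x = hnorm x.
Proof.
rewrite hdistC; have [->|/eqP x0] := eqVneq x hzero; first by rewrite hdistxx hnorm0.
by apply: hdistE => //; rewrite hopp0 hadd0.
Qed.

Lemma hdist_tri x y z : hdist x z <= Num.max (hdist x y) (hdist y z).
Proof.
have [->|/eqP xy] := eqVneq x y; first by rewrite hdistxx le_max lexx orbT.
have [->|/eqP yz] := eqVneq y z; first by rewrite hdistxx le_max lexx.
have [p xyp] := hadd_ne x (hopp y); have [q yzq] := hadd_ne y (hopp z).
rewrite (hdistE xy xyp) (hdistE yz yzq).
have [r pqr rzx] := haddAE' ((hadd_rev _ _ _).1 yzq) ((hadd_rev _ _ _).1 xyp).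
by apply: le_trans (hnormD pqr); apply/hdist_le/hadd_rev.
Qed.

Lemma hdistM x y z : hdist (x [*] z) (y [*] z) = hdist x y * hnorm z.
Proof.
have [->|/eqP z0] := eqVneq z hzero.
  by rewrite ![_ [*] hzero]hmulC !hmul0 hdistxx hnorm0 mulr0.
have [->|/eqP xy] := eqVneq x y; first by rewrite !hdistxx mul0r.
have [p xyp] := hadd_ne x (hopp y).
rewrite (hdistE xy xyp) (@hdistE _ _ (p [*] z)) ?hnormM//.
  move=> xzyz; apply: xy; have [u zu] := hmul_inv z0.
  by have := congr1 (fun t => t [*] u) xzyz; rewrite -!hmulA zu !hmul1.
by rewrite -hmulN; apply: hmulDE.
Qed.

(* Any point of a ball is a centre. *)
Lemma closed_hball_center (c p q : H) r :
  hdist c p <= r -> (hdist c q <= r) = (hdist p q <= r).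
Proof.
move=> cp; apply/idP/idP => h.
  by apply: le_trans (hdist_tri p c q) _; rewrite ge_max hdistC cp.
by apply: le_trans (hdist_tri c p q) _; rewrite ge_max cp.
Qed.

Lemma open_hball_center (c p q : H) r :
  hdist c p < r -> (hdist c q < r) = (hdist p q < r).
Proof.
move=> cp; apply/idP/idP => h.
  by apply: le_lt_trans (hdist_tri p c q) _; rewrite gt_max hdistC cp.
by apply: le_lt_trans (hdist_tri c p q) _; rewrite gt_max cp.
Qed.

Lemma is_hball_center (S : set H) (p : H) : is_hball S -> S p ->
  exists r : K, S = closed_hball p r \/ S = open_hball p r.
Proof.
move=> [c [r [->|->]]] Sp; exists r; [left|right]; apply/seteqP; split => q h.
- exact: (etrans (esym (closed_hball_center q Sp)) h).
- exact: (etrans (closed_hball_center q Sp) h).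
- exact: (etrans (esym (open_hball_center q Sp)) h).
- exact: (etrans (open_hball_center q Sp) h).
Qed.

Lemma hsubxx_le0 (r : K) x z : 0 < r -> sums_are_balls (@hnorm K H) r ->
  (x [-] x) z -> hnorm z <= r * hnorm x.
Proof.
move=> r0 [cl|op] xxz; have x0 := haddxN x.
  have [c cE] := cl x (hopp x); rewrite hnormN maxxx in cE.
  rewrite cE in x0 xxz.
  by have := closed_hball_center z x0; rewrite hdist0 => <-.
have [xE|/eqP xn0] := eqVneq x hzero.
  by move: xxz; rewrite xE => /hsubx0 ->; rewrite hnorm0 mulr0.
have [|c cE] := op x (hopp x); first by rewrite hnormN maxxx hnorm_gt0.
rewrite hnormN maxxx in cE; rewrite cE in x0 xxz.
by apply: ltW; have := open_hball_center z x0; rewrite hdist0 => <-.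
Qed.

Lemma hadd_absorb x e w y : (x [-] x) e -> hnorm w <= hnorm e ->
  (x [+] w) y -> y = x.
Proof.
move=> xxe we xwy; have yx : hdist x y <= hnorm w.
  by rewrite hdistC; apply/hdist_le/hadd_rev/haddCE.
have xx0 : (x [+] hzero) x by rewrite hadd0.
have [r r0 rb] := hnorm_ball H.
have [xE|/eqP xn0] := eqVneq x hzero.
  move: xxe; rewrite xE => /hsubx0 e0; rewrite e0 hnorm0 in we.
  by apply/esym/hdist_eq0; rewrite -xE (le_trans yx).
have m0 : Num.max (hnorm x) (hnorm (hzero : H)) = hnorm x.
  by rewrite hnorm0; apply/max_idPl/hnorm_ge0.
have xx : (x [-] x) hzero := haddxN x.
suff : (x [+] hzero) y by rewrite hadd0.
case: rb => [cl|op].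
  have [c cE] := cl x hzero; rewrite m0 in cE; rewrite cE in xx0 *.
  rewrite /closed_ball_of /= (closed_hball_center y xx0).
  apply: le_trans yx (le_trans we _).
  have [c' cE'] := cl x (hopp x); rewrite hnormN maxxx in cE'.
  rewrite cE' in xx xxe.
  by have := closed_hball_center e xx; rewrite hdist0 => <-.
have [|c cE] := op x hzero; first by rewrite m0 hnorm_gt0.
rewrite m0 in cE; rewrite cE in xx0 *.
rewrite /open_ball_of /= (open_hball_center y xx0).
apply: le_lt_trans yx (le_lt_trans we _).
have [|c' cE'] := op x (hopp x); first by rewrite hnormN maxxx hnorm_gt0.
rewrite hnormN maxxx in cE'; rewrite cE' in xx xxe.
by have := open_hball_center e xx; rewrite hdist0 => <-.
Qed.

Lemma rho_ge0 : 0 <= rho H.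
Proof.
have [r r0 rb] := hnorm_ball H.
by apply: lb_le_inf; [exists r|move=> s [/ltW]].
Qed.

Lemma hsubxx_le x z : (x [-] x) z -> hnorm z <= rho H * hnorm x.
Proof.
move=> xxz; have [xE|/eqP xn0] := eqVneq x hzero.
  by move: xxz; rewrite xE => /hsubx0 ->; rewrite hnorm0 mulr0.
have nx := hnorm_gt0 xn0; rewrite -ler_pdivrMr//.
have [r r0 rb] := hnorm_ball H.
apply: lb_le_inf; first by exists r.
by move=> s [s0 sb]; rewrite ler_pdivrMr// (hsubxx_le0 s0 sb).
Qed.

Lemma theta_ge0 : 0 <= theta H.
Proof.
rewrite /theta; set S := [set _ | _ in _]; have [[v Sv]|/set0P/negP/negPn/eqP->] := pselect (S !=set0); last by rewrite sup0.
apply: (@le_trans _ _ v); first by case: Sv => x _ <-; exact: hnorm_ge0.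
by apply: ub_le_sup => //; exists 1 => _ [x [_ /ltW ?] <-].
Qed.

End ValuedTheory.

Section Morphism.
Context (K : realType).

Record is_hmor (H1 H2 : valued_hyperfield K) (f : H1 -> H2) : Prop := IsHmor {
  hmor_mul : forall x y, f (x [*] y) = f x [*] f y;
  hmor_add : forall a b, range f a -> range f b ->
    f @^-1` (a [+] b) = hadds (f @^-1` [set a]) (f @^-1` [set b]);
  hmor_norm : forall x, hnorm (f x) = hnorm x;
  hmor_ball : is_hball (f @^-1` [set hone]) }.

Record hmor (H1 H2 : valued_hyperfield K) := Hmor {
  hmor_fun :> H1 -> H2;
  hmorP : is_hmor hmor_fun }.

End Morphism.

Section MorphismTheory.
Context (K : realType).

Section One.
Context (H1 H2 : valued_hyperfield K) (f : H1 -> H2) (fP : is_hmor f).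

Lemma hmor0 : f hzero = hzero.
Proof. by apply/hnorm_eq0; rewrite hmor_norm ?hnorm0. Qed.

Lemma hmor_eq0 x : f x = hzero -> x = hzero.
Proof. by move=> fx; apply/hnorm_eq0; rewrite -(hmor_norm fP) fx hnorm0. Qed.

Lemma hmor1 : f hone = hone.
Proof.
have f10 : f hone <> hzero by move/hmor_eq0/esym/(@hone_neq0 H1).
have [u fu] := hmul_inv f10.
have := hmor_mul fP hone hone; rewrite hmul1 => /(congr1 (fun t => t [*] u)).
by rewrite -hmulA fu hmul1.
Qed.

Lemma hmor_addE x y z : (x [+] y) z -> (f x [+] f y) (f z).
Proof.
move=> xyz; have : (f @^-1` (f x [+] f y)) z; last by [].
by rewrite (hmor_add fP)//; exists x => //; exists y.
Qed.

Lemma hmor_addI x y z : (f x [+] f y) (f z) ->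
  exists p q, [/\ f p = f x, f q = f y & (p [+] q) z].
Proof.
move=> fz; have : (f @^-1` (f x [+] f y)) z by [].
by rewrite (hmor_add fP)// => -[p ? [q ? ?]]; exists p, q.
Qed.

Lemma hmorN x : f (hopp x) = hopp (f x).
Proof. by apply/hadd_opp; rewrite -hmor0; apply/hmor_addE/haddxN. Qed.

Lemma hmor_near a p b : f p = f a -> hdist b a <= hdist p a -> f b = f a.
Proof.
move=> fpa bpa; have [aE|/eqP a0] := eqVneq a hzero.
  move: fpa bpa; rewrite aE hmor0 => /hmor_eq0 ->; rewrite hdistxx.
  by move=> /hdist_eq0 ->; rewrite hmor0.
have [u au] := hmul_inv a0.
have fau : f a [*] f u = hone by rewrite -(hmor_mul fP) au hmor1.
have Up : (f @^-1` [set hone]) (p [*] u) by rewrite /= (hmor_mul fP) fpa.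
have U1 : (f @^-1` [set hone]) hone := hmor1.
have bpu : hdist hone (b [*] u) <= hdist hone (p [*] u).
  by rewrite -au ![hdist (a [*] u) _]hdistC !hdistM ler_wpM2r ?hnorm_ge0.
suff : (f @^-1` [set hone]) (b [*] u).
  rewrite /= (hmor_mul fP) => /(congr1 (fun t => t [*] f a)).
  by rewrite -hmulA (hmulC (f u)) fau hmul1 (hmulC hone) hmul1.
have [r [rE|rE]] := is_hball_center (hmor_ball fP) U1; rewrite rE in Up *.
  exact: le_trans bpu Up.
exact: le_lt_trans bpu Up.
Qed.

Lemma hmor_near_scaled a c q b : f q = f c -> hnorm c <= hnorm a ->
  c <> hzero -> hdist b a <= hdist q c -> f b = f a.
Proof.
move=> fqc ca c0 bqc; have [u cu] := hmul_inv c0.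
apply: (@hmor_near a (q [*] (u [*] a))).
  by rewrite !(hmor_mul fP) fqc hmulA -(hmor_mul fP) cu hmor1 hmulC hmul1.
have aE : a = c [*] (u [*] a) by rewrite hmulA cu hmulC hmul1.
rewrite [X in _ <= hdist _ X]aE hdistM; apply: (le_trans bqc).
rewrite ler_peMr ?hdist_ge0//.
have c_gt0 := hnorm_gt0 c0.
by rewrite -(ler_pM2l c_gt0) mulr1 -hnormM -aE.
Qed.

End One.

Lemma is_hmor_id (H : valued_hyperfield K) : is_hmor (@id H).
Proof.
split=> // [a b _ _|].
  apply/seteqP; split=> z /=; first by exists a => //; exists b.
  by move=> [_ -> [_ -> ]].
exists hone, 0; left; apply/seteqP; split=> x /=; last by move/hdist_eq0.
by move=> ->; change (hdist (hone : H) hone <= 0); rewrite hdistxx.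
Qed.

Section Comp.
Context (H1 H2 H3 : valued_hyperfield K) (g : H2 -> H3) (f : H1 -> H2).
Context (gP : is_hmor g) (fP : is_hmor f).

Lemma hmor_comp_addI x y z : hnorm y <= hnorm x ->
  (g (f x) [+] g (f y)) (g (f z)) ->
  exists p q, [/\ g (f p) = g (f x), g (f q) = g (f y) & (p [+] q) z].
Proof.
move=> yx /(hmor_addI gP)[p [q [gp gq pqfz]]].
have [t xyt] := hadd_ne x y; have [w ztw] := hadd_ne z (hopp t).
have := hmor_addE fP ztw; rewrite (hmorN fP) => fw.
have ftN := haddN (hmor_addE fP xyt).
have [a [b [pa qb abfw]]] := haddACA pqfz ftN fw.
have ztw' := (hadd_rev _ _ _).1 ztw.
have [x' xwx' x'yz] : exists2 x', (x [+] w) x' & (x' [+] y) z.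
  have [s tsw] := haddAE xyt (haddCE ztw').
  move=> /[dup] xsz _; have [x' ? ?] := haddAE' (haddCE tsw) xsz.
  by exists x'.
exists x', y; split=> //.
have fx'w : hdist (f x') (f x) <= hnorm (f w).
  by apply/hdist_le/hadd_rev/haddCE/(hmor_addE fP).
have := hnormD abfw; rewrite le_max => /orP[wa|wb].
- have [pE|/eqP pfx] := eqVneq p (f x).
    rewrite pE in pa.
    by rewrite (hadd_absorb pa wa (hmor_addE fP xwx')).
  by apply: (hmor_near gP gp); rewrite (hdistE pfx pa) (le_trans fx'w).
- have [y0|/eqP y0] := eqVneq y hzero.
    have q0 : q = hzero by apply: (hmor_eq0 gP); rewrite gq y0 (hmor0 fP) (hmor0 gP).
    move: qb; rewrite q0 y0 (hmor0 fP) => /hsubx0 b0.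
    rewrite b0 hnorm0 in wb.
    by rewrite (hdist_eq0 (le_trans fx'w wb)).
  have fy0 : f y <> hzero by move/(hmor_eq0 fP).
  have fyx : hnorm (f y) <= hnorm (f x) by rewrite !(hmor_norm fP).
  have [qE|/eqP qfy] := eqVneq q (f y); last first.
    apply: (hmor_near_scaled gP gq fyx fy0).
    by rewrite (hdistE qfy qb) (le_trans fx'w).
  have [u fyu] := hmul_inv fy0.
  have fxE : f y [*] (u [*] f x) = f x by rewrite hmulA fyu hmulC hmul1.
  rewrite qE in qb; have := hmulDE (u [*] f x) qb; rewrite hmulN fxE => xxe.
  rewrite (hadd_absorb xxe _ (hmor_addE fP xwx'))//.
  apply: (le_trans wb); rewrite hnormM ler_peMr ?hnorm_ge0//.
  by rewrite -(ler_pM2l (hnorm_gt0 fy0)) mulr1 -hnormM fxE.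
Qed.

Lemma is_hmor_comp : is_hmor (g \o f).
Proof.
split=> [x y|_ _ [x _ <-] [y _ <-]|x|].
- by rewrite /= (hmor_mul fP) (hmor_mul gP).
- apply/seteqP; split=> z /=.
    have [yx|/ltW xy] := leP (hnorm y) (hnorm x).
      by move/(hmor_comp_addI yx) => [p [q [gp gq pq]]]; exists p => //; exists q.
    move/haddCE/(hmor_comp_addI xy) => [p [q [gp gq /haddCE pq]]].
    by exists q => //; exists p.
  by move=> [p /= <- [q /= <-]] /(hmor_addE fP)/(hmor_addE gP).
- by rewrite /= (hmor_norm gP) (hmor_norm fP).
have U1 : (g @^-1` [set hone]) hone := hmor1 gP.
have V1 : (f @^-1` [set hone]) hone := hmor1 fP.
have fd u : f u <> hone -> hdist hone (f u) = hdist hone u.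
  move=> fu; have [z uz] := hadd_ne hone (hopp u).
  have := hmor_addE fP uz; rewrite (hmorN fP) (hmor1 fP) => fuz.
  rewrite (hdistE _ uz) ?(hdistE _ fuz) ?(hmor_norm fP)//; first by move/esym.
  by move=> u1; apply: fu; rewrite -u1 (hmor1 fP).
have [r rE] := is_hball_center (hmor_ball gP) U1.
have [s sE] := is_hball_center (hmor_ball fP) V1.
have [P [Pball PU Ple]] : exists P : set H1, [/\ is_hball P,
    forall u, f u <> hone -> g (f u) = hone <-> P u &
    forall u v, hdist hone u <= hdist hone v -> P v -> P u].
  case: rE => rE; [exists (closed_hball hone r)|exists (open_hball hone r)]; split.
  - by exists hone, r; left.
  - move=> u fu; have -> : g (f u) = hone <-> (g @^-1` [set hone]) (f u) by [].
    rewrite rE; have -> : closed_hball hone r (f u) = (hdist hone (f u) <= r) by [].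
    by rewrite fd.
  - by move=> u v; apply: le_trans.
  - by exists hone, r; right.
  - move=> u fu; have -> : g (f u) = hone <-> (g @^-1` [set hone]) (f u) by [].
    rewrite rE; have -> : open_hball hone r (f u) = (hdist hone (f u) < r) by [].
    by rewrite fd.
  - by move=> u v; apply: le_lt_trans.
have Qle u v : hdist hone u <= hdist hone v -> f v = hone -> f u = hone.
  move=> uv; have : (f @^-1` [set hone]) v -> (f @^-1` [set hone]) u; last by [].
  by case: sE => ->; [apply: le_trans|apply: le_lt_trans].
have [QP|/existsNP[v /not_implyP[fv Pv]]] := pselect (forall u, f u = hone -> P u).
  suff -> : (g \o f) @^-1` [set hone] = P by [].
  apply/seteqP; split=> u /=.
    by move=> gfu; have [/QP//|/eqP/PU <-] := eqVneq (f u) hone.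
  by have [-> _|/eqP/PU gfu /gfu//] := eqVneq (f u) hone; rewrite (hmor1 gP).
suff -> : (g \o f) @^-1` [set hone] = f @^-1` [set hone] by exact: hmor_ball.
apply/seteqP; split=> u /= => [gfu|->]; last exact: hmor1 gP.
have [//|/eqP fu] := eqVneq (f u) hone.
have [uv|/ltW vu] := leP (hdist hone u) (hdist hone v); first exact: Qle uv fv.
by case: Pv; apply: Ple vu _; apply/PU.
Qed.

End Comp.
End MorphismTheory.

Definition hmor_id (K : realType) (H : valued_hyperfield K) : hmor H H :=
  Hmor (is_hmor_id H).

Definition hmor_comp (K : realType) (H1 H2 H3 : valued_hyperfield K)
    (g : hmor H2 H3) (f : hmor H1 H2) : hmor H1 H3 :=
  Hmor (is_hmor_comp (hmorP g) (hmorP f)).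

Section Quotient.
Context (K : realType) (H : valued_hyperfield K) (i : int).
Implicit Types (x y z : H).

Definition mpow : {pred H} := [pred x | hdist hzero x <= theta H ^ i].

Definition mball := {x : H | x \in mpow}.

Definition mball_rel (x y : mball) : bool :=
  hdist (val x) (val y) <= rho H * theta H ^ i.

Lemma mpowE x : (x \in mpow) = (hnorm x <= theta H ^ i).
Proof. by rewrite inE hdist0. Qed.

Lemma theta_exp_ge0 : 0 <= theta H ^ i.
Proof. exact/exprz_ge0/theta_ge0. Qed.

Lemma mball_rel_refl : reflexive mball_rel.
Proof. by move=> x; rewrite /mball_rel hdistxx mulr_ge0 ?rho_ge0 ?theta_exp_ge0. Qed.

Lemma mball_rel_sym : symmetric mball_rel.
Proof. by move=> x y; rewrite /mball_rel hdistC. Qed.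

Lemma mball_rel_trans : transitive mball_rel.
Proof.
move=> y x z xy yz; apply: le_trans (hdist_tri _ (val y) _) _.
by rewrite ge_max; apply/andP.
Qed.

Canonical mball_equiv :=
  EquivRel mball_rel mball_rel_refl mball_rel_sym mball_rel_trans.

Definition mquot := {eq_quot mball_equiv}.

HB.instance Definition _ := Choice.on mquot.
HB.instance Definition _ := EqQuotient.on mquot.

Lemma mpow0 : hzero \in mpow.
Proof. by rewrite mpowE hnorm0 theta_exp_ge0. Qed.

Definition mball0 : mball := Sub hzero mpow0.

(* The class of [x], for [x \in mpow]; the class of 0 otherwise. *)
Definition mclass (x : H) : mquot := \pi_mquot (insubd mball0 x).

Definition mlift (a : mquot) : H := val (repr a).

Lemma mlift_in a : mlift a \in mpow. Proof. exact: valP. Qed.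

Lemma mliftK a : mclass (mlift a) = a.
Proof. by rewrite /mclass valKd reprK. Qed.

Lemma mclass_eq x y : x \in mpow -> y \in mpow ->
  mclass x = mclass y <-> hdist x y <= rho H * theta H ^ i.
Proof.
move=> xm ym; split=> [/eqmodP|xy]; last apply/eqmodP;
  by rewrite /= /mball_rel !insubdK.
Qed.

Lemma mpow_add x y z : x \in mpow -> y \in mpow -> (x [+] y) z -> z \in mpow.
Proof.
rewrite !mpowE => xm ym /hnormD h; apply: le_trans h _.
by rewrite ge_max xm.
Qed.

Lemma mpow_opp x : x \in mpow -> hopp x \in mpow.
Proof. by rewrite !mpowE hnormN. Qed.

Lemma mclass_sub x y z : x \in mpow -> y \in mpow -> mclass x = mclass y ->
  (x [-] y) z -> hnorm z <= rho H * theta H ^ i.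
Proof.
move=> xm ym /(mclass_eq xm ym) xy xyz.
have [xE|/eqP xn] := eqVneq x y; last by rewrite -(hdistE xn xyz).
rewrite -xE in xyz; apply: le_trans (hsubxx_le xyz) _.
by rewrite ler_wpM2l ?rho_ge0// -mpowE.
Qed.

Lemma mclass_add_eq x y z x' y' z' :
  x \in mpow -> y \in mpow -> x' \in mpow -> y' \in mpow ->
  mclass x = mclass x' -> mclass y = mclass y' ->
  (x [+] y) z -> (x' [+] y') z' -> mclass z = mclass z'.
Proof.
move=> xm ym x'm y'm xx' yy' xyz xyz'.
apply/mclass_eq; [exact: mpow_add xyz|exact: mpow_add xyz'|].
have [w zzw] := hadd_ne z (hopp z').
have [a [b [xxa yyb abw]]] := haddACA xyz (haddN xyz') zzw.
apply: le_trans (hdist_le zzw) _; apply: le_trans (hnormD abw) _.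
by rewrite ge_max (mclass_sub xm x'm xx' xxa) (mclass_sub ym y'm yy' yyb).
Qed.

Definition mzero : mquot := mclass hzero.
Definition mopp (a : mquot) : mquot := mclass (hopp (mlift a)).
Definition madd (a b : mquot) : mquot :=
  mclass (xget hzero (mlift a [+] mlift b)).

Lemma maddE x y z : x \in mpow -> y \in mpow -> (x [+] y) z ->
  madd (mclass x) (mclass y) = mclass z.
Proof.
move=> xm ym xyz; rewrite /madd; set w := xget _ _.
have xyw : (mlift (mclass x) [+] mlift (mclass y)) w 
  by apply: xgetPex; exact: hadd_ne.
by apply: (mclass_add_eq _ _ xm ym _ _ xyw xyz); rewrite ?mlift_in ?mliftK.
Qed.

Lemma mclassP (a : mquot) : exists2 x, x \in mpow & a = mclass x.
Proof. by exists (mlift a); rewrite ?mlift_in ?mliftK. Qed.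

Lemma maddA : associative madd.
Proof.
move=> a b c; have [x xm ->] := mclassP a.
have [y ym ->] := mclassP b; have [z zm ->] := mclassP c.
have [t xyt] := hadd_ne x y; have [u tzu] := hadd_ne t z.
have [s yzs xsu] := haddAE xyt tzu.
rewrite (maddE xm ym xyt) (maddE ym zm yzs) (maddE xm _ xsu) ?(maddE _ zm tzu)//.
  exact: mpow_add xyt.
exact: mpow_add yzs.
Qed.

Lemma maddC : commutative madd.
Proof. by move=> a b; rewrite /madd haddC. Qed.

Lemma madd0 : left_id mzero madd.
Proof.
move=> a; have [x xm ->] := mclassP a.
by rewrite (maddE mpow0 xm (z := x))// haddC hadd0.
Qed.

Lemma maddN : left_inverse mzero mopp madd.
Proof.
move=> a; rewrite -{2}[a]mliftK (maddE _ _ (z := hzero)) ?mpow_opp ?mlift_in//.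
exact/haddCE/haddxN.
Qed.

HB.instance Definition _ := GRing.isZmodule.Build mquot maddA maddC madd0 maddN.

Lemma mclassD x y z : x \in mpow -> y \in mpow -> (x [+] y) z ->
  mclass x + mclass y = mclass z.
Proof. exact: maddE. Qed.

End Quotient.

Arguments mpow {K} H i.
Arguments mquot {K} H i.
Arguments mclass {K H} i x.

Section QuotientMul.
Context (K : realType) (H : valued_hyperfield K).

(* [M_i] is acted upon by [M_0] through the product of lifts; for [i = 0] this
   is the multiplication of [M_0]. *)
Definition mmul (i : int) (a : mquot H 0) (b : mquot H i) : mquot H i :=
  mclass i (mlift a [*] mlift b).

Lemma mpow_mul i (x y : H) :
  x \in mpow H 0 -> y \in mpow H i -> x [*] y \in mpow H i.
Proof.
rewrite !mpowE expr0z hnormM => x1 yi.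
by apply: le_trans yi; rewrite ler_piMl ?hnorm_ge0.
Qed.

Lemma mmulE i (x y : H) : x \in mpow H 0 -> y \in mpow H i ->
  mmul (mclass 0 x) (mclass i y) = mclass i (x [*] y).
Proof.
move=> xm ym; rewrite /mmul.
set x' := mlift _; set y' := mlift _.
have x'm : x' \in mpow H 0 by exact: mlift_in.
have y'm : y' \in mpow H i by exact: mlift_in.
have : mclass 0 x' = mclass 0 x by exact: mliftK.
have : mclass i y' = mclass i y by exact: mliftK.
move/(mclass_eq y'm ym) => yy' /(mclass_eq x'm xm); rewrite expr0z mulr1 => xx'.
apply/mclass_eq; [exact: mpow_mul|exact: mpow_mul|].
apply: le_trans (hdist_tri _ (x [*] y') _) _; rewrite ge_max; apply/andP; split.
  by rewrite hdistM ler_pM ?hdist_ge0 ?hnorm_ge0// -mpowE.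
rewrite ![x [*] _]hmulC hdistM; apply: le_trans yy'.
by rewrite ler_piMr ?hdist_ge0//; move: xm; rewrite mpowE expr0z.
Qed.

Lemma hone_in : (hone : H) \in mpow H 0.
Proof. by rewrite mpowE expr0z hnorm1. Qed.

Lemma mmulA i (a b : mquot H 0) (c : mquot H i) :
  mmul a (mmul b c) = mmul (mmul a b) c.
Proof.
have [x xm ->] := mclassP a; have [y ym ->] := mclassP b.
have [z zm ->] := mclassP c.
by rewrite !mmulE ?mpow_mul// hmulA.
Qed.

Lemma mmul1 i : left_id (mclass 0 hone) (@mmul i).
Proof.
move=> a; have [x xm ->] := mclassP a.
by rewrite mmulE ?hone_in// hmulC hmul1.
Qed.

Lemma mmulDr i : right_distributive (@mmul i) +%R.
Proof.
move=> a b c; have [x xm ->] := mclassP a; have [y ym ->] := mclassP b.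
have [z zm ->] := mclassP c; have [t yzt] := hadd_ne y z.
rewrite (mclassD ym zm yzt) !mmulE ?(mpow_add ym zm yzt)//.
apply/esym/mclassD; rewrite ?mpow_mul// ![x [*] _]hmulC; exact: hmulDE.
Qed.

Lemma mmulDl i (c : mquot H i) : {morph (fun a => mmul a c) : a b / a + b}.
Proof.
move=> a b; have [x xm ->] := mclassP a; have [y ym ->] := mclassP b.
have [z zm ->] := mclassP c; have [t xyt] := hadd_ne x y.
rewrite (mclassD xm ym xyt) !mmulE ?(mpow_add xm ym xyt)//.
by apply/esym/mclassD; rewrite ?mpow_mul//; exact: hmulDE.
Qed.

Lemma mmulC : commutative (@mmul 0).
Proof. by move=> a b; rewrite /mmul hmulC. Qed.

Definition tr_ring := mquot H 0.

HB.instance Definition _ := GRing.Zmodule.on tr_ring.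
HB.instance Definition _ := GRing.Zmodule_isComPzRing.Build tr_ring
  (@mmulA 0) mmulC (@mmul1 0) (fun a b c => mmulDl c a b).

HB.instance Definition _ (i : int) :=
  GRing.Zmodule_isLmodule.Build tr_ring (mquot H i)
    (@mmulA i) (@mmul1 i) (@mmulDr i) (@mmulDl i).

End QuotientMul.

Section Presented.
Context (A : comPzRingType) (X : choiceType).
Context (P : forall N : lmodType A, (X -> N) -> Prop).

Definition lincomb (N : lmodType A) (g : X -> N) (s : seq (A * X)) : N :=
  \sum_(p <- s) p.1 *: g p.2.

Definition presented_rel (s t : seq (A * X)) : bool :=
  `[< forall (N : lmodType A) (g : X -> N), P g -> lincomb g s = lincomb g t >].

Lemma presented_rel_refl : reflexive presented_rel.
Proof. by move=> s; apply/asboolP. Qed.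

Lemma presented_rel_sym : symmetric presented_rel.
Proof. by move=> s t; apply/asboolP/asboolP => h N g Pg; rewrite h. Qed.

Lemma presented_rel_trans : transitive presented_rel.
Proof.
move=> t s u /asboolP st /asboolP tu; apply/asboolP => N g Pg.
by rewrite st ?tu.
Qed.

Canonical presented_equiv := EquivRel presented_rel
  presented_rel_refl presented_rel_sym presented_rel_trans.

(* The free module on [X] modulo the relations that hold in the image of every
   map [g : X -> N] with [P g], for [N] an arbitrary module. When [P] is given
   by linear relations, [pgen : X -> presented] is thus the universal map
   satisfying [P]. *)
Definition presented := {eq_quot presented_equiv}.

HB.instance Definition _ := Choice.on presented.
HB.instance Definition _ := EqQuotient.on presented.

Definition pgen (x : X) : presented := \pi_presented [:: (1, x)].

Lemma presentedP s t : \pi_presented s = \pi_presented t <->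
  forall (N : lmodType A) (g : X -> N), P g -> lincomb g s = lincomb g t.
Proof.
split; first by move/eqmodP/asboolP.
by move=> h; apply/eqmodP/asboolP.
Qed.

Lemma lincomb_repr s (N : lmodType A) (g : X -> N) : P g ->
  lincomb g (repr (\pi_presented s)) = lincomb g s.
Proof. by move: N g; apply/presentedP; rewrite reprK. Qed.

Lemma lincomb_cat (N : lmodType A) (g : X -> N) s t :
  lincomb g (s ++ t) = lincomb g s + lincomb g t.
Proof. exact: big_cat. Qed.

Definition fscale (a : A) (s : seq (A * X)) := [seq (a * p.1, p.2) | p <- s].

Lemma lincomb_scale (N : lmodType A) (g : X -> N) a s :
  lincomb g (fscale a s) = a *: lincomb g s.
Proof.
rewrite /lincomb big_map scaler_sumr.
by apply: eq_bigr => p _; rewrite scalerA.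
Qed.

Lemma lincomb_nil (N : lmodType A) (g : X -> N) : lincomb g [::] = 0.
Proof. exact: big_nil. Qed.

Definition pzero : presented := \pi_presented [::].
Definition padd (t u : presented) : presented := \pi_presented (repr t ++ repr u).
Definition pscale (a : A) (t : presented) : presented :=
  \pi_presented (fscale a (repr t)).
Definition popp (t : presented) : presented := pscale (-1) t.

Lemma presented_pi t : exists s, t = \pi_presented s.
Proof. by exists (repr t); rewrite reprK. Qed.

Lemma padd_pi s t :
  padd (\pi_presented s) (\pi_presented t) = \pi_presented (s ++ t).
Proof. by apply/presentedP => N g Pg; rewrite !lincomb_cat !lincomb_repr. Qed.

Lemma pscale_pi a s : pscale a (\pi_presented s) = \pi_presented (fscale a s).
Proof. by apply/presentedP => N g Pg; rewrite !lincomb_scale !lincomb_repr. Qed.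

Lemma paddA : associative padd.
Proof.
move=> t u v; have [s1 ->] := presented_pi t; have [s2 ->] := presented_pi u.
have [s3 ->] := presented_pi v.
by rewrite (padd_pi s1 s2) (padd_pi s2 s3) !padd_pi catA.
Qed.

Lemma paddC : commutative padd.
Proof.
move=> t u; have [s1 ->] := presented_pi t; have [s2 ->] := presented_pi u.
rewrite !padd_pi.
by apply/presentedP => N g Pg; rewrite !lincomb_cat addrC.
Qed.

Lemma padd0 : left_id pzero padd.
Proof. by move=> t; have [s ->] := presented_pi t; rewrite padd_pi. Qed.

Lemma paddN : left_inverse pzero popp padd.
Proof.
move=> t; have [s ->] := presented_pi t; rewrite /popp pscale_pi padd_pi.
apply/presentedP => N g Pg.
by rewrite lincomb_cat lincomb_scale lincomb_nil scaleN1r addNr.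
Qed.

HB.instance Definition _ :=
  GRing.isZmodule.Build presented paddA paddC padd0 paddN.

Lemma pscaleA a b t : pscale a (pscale b t) = pscale (a * b) t.
Proof.
have [s ->] := presented_pi t; rewrite (pscale_pi b s) !pscale_pi.
by apply/presentedP => N g Pg; rewrite !lincomb_scale scalerA.
Qed.

Lemma pscale1 : left_id 1 pscale.
Proof.
move=> t; have [s ->] := presented_pi t; rewrite pscale_pi; apply/presentedP => N g Pg.
by rewrite lincomb_scale scale1r.
Qed.

Lemma pscaleDr : right_distributive pscale +%R.
Proof.
move=> a t u; have [s1 ->] := presented_pi t; have [s2 ->] := presented_pi u.
rewrite -[LHS]/(pscale a (padd _ _)) -[RHS]/(padd _ _).
rewrite (padd_pi s1 s2) !pscale_pi padd_pi.
apply/presentedP => N g Pg.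
by rewrite !(lincomb_scale, lincomb_cat) scalerDr.
Qed.

Lemma pscaleDl t : {morph pscale^~ t : a b / a + b}.
Proof.
move=> a b; have [s ->] := presented_pi t.
rewrite /= -[RHS]/(padd _ _) !pscale_pi padd_pi.
apply/presentedP => N g Pg.
by rewrite !(lincomb_scale, lincomb_cat) scalerDl.
Qed.

HB.instance Definition _ := GRing.Zmodule_isLmodule.Build A presented
  pscaleA pscale1 pscaleDr pscaleDl.

(* The extension of [g : X -> N] along [phi : A -> B]; it does not depend on
   the chosen representative when [g] satisfies the defining relations. *)
Definition pext (B : comPzRingType) (phi : A -> B) (N : lmodType B) (g : X -> N)
  (t : presented) : N := \sum_(p <- repr t) phi p.1 *: g p.2.

End Presented.

Section TensorPower.
Context (R : comPzRingType) (M : lmodType R).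

Definition ffset n (v : {ffun 'I_n -> M}) (i : 'I_n) (x : M) : {ffun 'I_n -> M} :=
  [ffun j => if j == i then x else v j].

Definition multilinear n (N : lmodType R) (g : {ffun 'I_n -> M} -> N) : Prop :=
  forall v i a x y,
    g (ffset v i (a *: x + y)) = a *: g (ffset v i x) + g (ffset v i y).

(* [M^{(x) n}] *)
Definition tpow n : lmodType R := presented (@multilinear n).

Definition pure n (v : {ffun 'I_n -> M}) : tpow n := pgen (@multilinear n) v.

Definition ffcat m n (v : {ffun 'I_m -> M}) (w : {ffun 'I_n -> M}) :
    {ffun 'I_(m + n) -> M} :=
  [ffun k => match fintype.split k with inl i => v i | inr j => w j end].

Definition tmul m n (t : tpow m) (u : tpow n) : tpow (m + n) :=
  pext id (fun v => pext id (fun w => pure (ffcat v w)) u) t.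

(* [F 0 (x) ... (x) F (n - 1)], in [(M^{(x) r})^{(x) n} = M^{(x) (n * r)}] *)
Fixpoint tprod r n : ('I_n -> tpow r) -> tpow (n * r) :=
  match n return ('I_n -> tpow r) -> tpow (n * r) with
  | 0 => fun _ => pure [ffun=> 0]
  | n'.+1 => fun F => tmul (F ord0) (tprod (fun i => F (lift ord0 i)))
  end.

End TensorPower.

Arguments pure {R M n} v.

(* [eta^{(x) n} : M^{(x) n} -> M'^{(x) n r}] for [eta : M -> M'^{(x) r}]
   semilinear along [phi]. *)
Definition tpow_map (R R' : comPzRingType) (phi : R -> R')
    (M : lmodType R) (M' : lmodType R') r (eta : M -> tpow M' r) n :
    tpow M n -> tpow M' (n * r) :=
  pext phi (fun v : {ffun 'I_n -> M} => tprod (fun i => eta (v i))).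

Section BaseChange.
Context (R R' : comPzRingType) (phi : R -> R') (M : lmodType R).

Definition semilinear_along (N : lmodType R') (g : M -> N) : Prop :=
  forall a x y, g (a *: x + y) = phi a *: g x + g y.

(* [M (x)_R R'] *)
Definition base_change : lmodType R' := presented semilinear_along.

Definition base_change_map (N : lmodType R') (g : M -> N) : base_change -> N :=
  pext id g.

End BaseChange.

Arguments base_change_map {R R'} phi {M N} g t.

Section Ideals.
Context (R : comPzRingType).

Definition is_ideal (I : set R) : Prop :=
  [/\ I 0, forall x y, I x -> I y -> I (x + y) & forall a x, I x -> I (a * x)].

Definition is_maximal_ideal (I : set R) : Prop :=
  [/\ is_ideal I, I <> setT &
      forall J, is_ideal J -> I `<=` J -> J = I \/ J = setT].

Definition is_local : Prop := exists! I, is_maximal_ideal I.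

Definition is_artinian : Prop :=
  forall I : nat -> set R, (forall n, is_ideal (I n)) ->
    (forall n, I n.+1 `<=` I n) ->
    exists n, forall m, (n <= m)%N -> I m = I n.

Definition is_principal (I : set R) : Prop :=
  exists a, I = range (fun b : R => b * a).

Definition is_truncated_dvr : Prop :=
  [/\ is_local, is_artinian & forall I, is_maximal_ideal I -> is_principal I].

Definition is_free_rank1 (M : lmodType R) : Prop :=
  exists x : M, bijective (fun a : R => a *: x).

End Ideals.

Record triple_data := TripleData {
  tring : comPzRingType;
  tmod : lmodType tring;
  teps : tmod -> tring }.

Definition is_triple (T : triple_data) : Prop :=
  [/\ is_truncated_dvr (tring T), is_free_rank1 (tmod T),
      scalar (@teps T) & is_maximal_ideal (range (@teps T))].

(* [epsilon_{0,n} : M^{(x) n} -> R] is the linear map sending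
   [x_1 (x) ... (x) x_n] to the product of the [epsilon(x_i)], hence
   [x^{(x) n}] to [epsilon(x)^n]. *)
Definition teps0 (T : triple_data) (n : nat) : tpow (tmod T) n -> tring T :=
  pext id
    (fun v : {ffun 'I_n -> tmod T} => (\prod_(i < n) teps (v i) : (tring T)^o)).

(* Only degrees [r >= 0] occur: the compatibility with epsilon involves
   [epsilon'_{0,r}], which is defined for [r >= 0]. *)
Record tmor_data (T T' : triple_data) := TMorData {
  tdeg : nat;
  tphi : tring T -> tring T';
  teta : tmod T -> tpow (tmod T') tdeg }.

Record is_tmor (T T' : triple_data) (m : tmor_data T T') : Prop := IsTMor {
  tmor_additive : GRing.zmod_morphism (tphi m);
  tmor_multiplicative : GRing.monoid_morphism (tphi m);
  tmor_semilinear : semilinear_along (tphi m) (teta m);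
  tmor_eps : forall x, tphi m (teps x) = teps0 (teta m x);
  tmor_iso : bijective (base_change_map (tphi m) (teta m)) }.

Definition tmor_id (T : triple_data) : tmor_data T T :=
  @TMorData T T 1 id (fun x => pure [ffun=> x]).

Definition tmor_comp (T T' T'' : triple_data)
    (m' : tmor_data T' T'') (m : tmor_data T T') : tmor_data T T'' :=
  @TMorData T T'' (tdeg m * tdeg m') (tphi m' \o tphi m)
    (tpow_map (tphi m') (teta m') (n := tdeg m) \o teta m).

Section Tr.
Context (K : realType).

Definition hexp (H : hyperfield) (x : H) (n : nat) : H := iter n (hmul x) hone.

(* The identification of [M_n] with [M_1^{(x) n}] for a uniformizer [p]:
   [c] times the class of [p^n] goes to [c] times the [n]-th tensor power of the
   class of [p]. *)
Definition tens_id (H : valued_hyperfield K) (p : H) (n : nat)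
    (a : mquot H n%:Z) : tpow (mquot H 1) n :=
  xget 0 [set c : tr_ring H | a = c *: mclass n%:Z (hexp p n)]
    *: pure [ffun=> mclass 1 p].

Definition Tr (H : dv_hyperfield K) : triple_data :=
  @TripleData (tr_ring H) (mquot H 1) (fun a => mclass 0 (mlift a)).

Definition Tr_deg (H H' : valued_hyperfield K) : nat :=
  xget 0%N [set r : nat | r%:R = ln (theta H) / ln (theta H')].

Definition Tr_map (H H' : dv_hyperfield K) (f : hmor H H') :
    tmor_data (Tr H) (Tr H') :=
  @TMorData (Tr H) (Tr H') (Tr_deg H H')
    (fun a : tr_ring H => mclass 0 (f (mlift a)))
    (fun a : mquot H 1 =>
       tens_id (xget hone (@uniformizer K H'))
         (mclass (Tr_deg H H')%:Z (f (mlift a)))).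

End Tr.

(* Main.v *)
From HB Require Import structures.
Require Import Defs.
From mathcomp Require Import all_boot all_order all_algebra.
From mathcomp Require Import generic_quotient.
From mathcomp Require Import all_classical all_reals all_analysis.

Set Implicit Arguments.
Unset Strict Implicit.
Unset Printing Implicit Defensive.

Import Order.TTheory GRing.Theory Num.Theory Defs.
Import numFieldNormedType.Exports.
Local Open Scope classical_set_scope.
Local Open Scope ring_scope.

(* In a discretely valued hyperfield that is not a field the values are 0 and the
   powers of theta, and rho is the largest value taken on 1 - 1, which lies
   strictly between 0 and 1. Hence multiplication by an element of value theta^i
   identifies M_0 with M_i, every element of R = M_0 is a unit or lies in the
   image of epsilon, and powers of a uniformizer vanish in R eventually.
   A morphism f preserves values and maps 1 - 1 into 1 - 1, so that
   rho_H <= rho_H' and f descends to the quotients M_i. All modules in sight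
   being free of rank 1, it remains to compare generators: the tensor power
   eta'^{(x) r} sends the generator p'^{(x) r} to the r-th power of the class
   of f'(p'). *)

Local Notation "x [+] y" := (hadd x y) (at level 50, left associativity).
Local Notation "x [-] y" := (hadd x (hopp y)) (at level 50, left associativity).
Local Notation "x [*] y" := (hmul x y) (at level 40, left associativity).

(** * Presented modules and tensor powers *)

(* Restriction of scalars along [phi] turns the extension [pext phi g] into a
   linear combination in an [A]-module, to which the presentation applies. *)
Definition restr (A B : comPzRingType) (phi : {rmorphism A -> B})
  (N : lmodType B) : Type := N.

Section RestrictionOfScalars.
Context (A B : comPzRingType) (phi : {rmorphism A -> B}) (N : lmodType B).

Local Notation rN := (restr phi N).
HB.instance Definition _ := GRing.Zmodule.copy rN N.

Definition restr_scale (a : A) (v : rN) : rN := phi a *: (v : N).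

Fact restr_scaleA a b v : restr_scale a (restr_scale b v) = restr_scale (a * b) v.
Proof. by rewrite /restr_scale scalerA rmorphM. Qed.

Fact restr_scale1 : left_id 1 restr_scale.
Proof. by move=> v; rewrite /restr_scale rmorph1 scale1r. Qed.

Fact restr_scaleDr : right_distributive restr_scale +%R.
Proof. by move=> a u v; rewrite /restr_scale scalerDr. Qed.

Fact restr_scaleDl v : {morph restr_scale^~ v : a b / a + b}.
Proof. by move=> a b; rewrite /restr_scale rmorphD scalerDl. Qed.

HB.instance Definition _ := GRing.Zmodule_isLmodule.Build A rN
  restr_scaleA restr_scale1 restr_scaleDr restr_scaleDl.

End RestrictionOfScalars.

Section PresentedTheory.
Local Open Scope quotient_scope.
Context (A B : comPzRingType) (X : choiceType).
Context (P : forall N : lmodType A, (X -> N) -> Prop).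
Context (phi : {rmorphism A -> B}) (N : lmodType B) (g : X -> N).
Context (Pg : @P (restr phi N) g).

(** [pext] sums over a chosen representative. Since [g] satisfies the relations as a map into the
    restricted module, the sum depends only on the class. *)
Lemma pext_pi s : pext phi g (\pi_(presented P) s) = \sum_(p <- s) phi p.1 *: g p.2.
Proof.
have E (r : seq (A * X)) :
  \sum_(p <- r) p.1 *: (g p.2 : restr phi N) = \sum_(p <- r) phi p.1 *: g p.2 by [].
have := @lincomb_repr _ _ P s (restr phi N) g Pg.
by rewrite /lincomb /pext -![in RHS]E -[LHS]E => ->.
Qed.

Lemma pext_gen x : pext phi g (pgen P x) = g x.
Proof. by rewrite pext_pi big_seq1 rmorph1 scale1r. Qed.

Lemma pext_linear a (t u : presented P) :
  pext phi g (a *: t + u) = phi a *: pext phi g t + pext phi g u.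
Proof.
have [s ->] := presented_pi t; have [r ->] := presented_pi u.
rewrite -[_ + _]/(padd (pscale _ _) _) pscale_pi padd_pi !pext_pi big_cat big_map.
congr (_ + _); rewrite scaler_sumr; apply: eq_bigr => p _.
by rewrite rmorphM scalerA.
Qed.

End PresentedTheory.

Lemma presented_ind (A : comPzRingType) (X : choiceType)
    (P : forall N : lmodType A, (X -> N) -> Prop) (Q : presented P -> Prop) :
  Q 0 -> (forall a x t, Q t -> Q (a *: pgen P x + t)) -> forall t, Q t.
Proof.
move=> Q0 Qs t; have [s ->] := presented_pi t.
(* Putting a pair in front of the list adds a multiple of a generator. As a generator is the list
   [[:: (1, x)]], the coefficient appears as [a * 1]. *)
elim: s => [//|[a x] s IH]; move: (Qs a x _ IH).
by rewrite -[_ + _]/(padd (pscale _ _) _) pscale_pi padd_pi /= mulr1.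
Qed.

(** * Free modules of rank one and their tensor powers *)

Section FreeRankOne.
Context (R : comPzRingType) (M : lmodType R) (x : M).
Context (x_free : bijective (fun a : R => a *: x)).

Lemma free1_inj (a b : R) : a *: x = b *: x -> a = b.
Proof. exact: (bij_inj x_free). Qed.

Lemma free1_span (m : M) : exists a : R, m = a *: x.
Proof. by case: x_free => c _ cK; exists (c m); rewrite cK. Qed.

Definition free1_coord (m : M) : R := projT1 (cid (free1_span m)).

Lemma free1_coordK m : m = free1_coord m *: x.
Proof. exact: projT2 (cid (free1_span m)). Qed.

Lemma free1_coord_linear a u v :
  free1_coord (a *: u + v) = a * free1_coord u + free1_coord v.
Proof.
by apply: free1_inj; rewrite -free1_coordK scalerDl -scalerA -!free1_coordK.
Qed.

Lemma free1_coordE a : free1_coord (a *: x) = a.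
Proof. by apply: free1_inj; rewrite -free1_coordK. Qed.

End FreeRankOne.

Lemma bij_of_inj_surj (T U : Type) (h : T -> U) :
  injective h -> (forall u, exists t, h t = u) -> bijective h.
Proof.
move=> hI /choice[k kK]; exists k => // t; exact/hI/kK.
Qed.

Section TensorTheory.
Context (R : comPzRingType) (M : lmodType R).

Lemma ffset_id n (v : {ffun 'I_n -> M}) i : ffset v i (v i) = v.
Proof. by apply/ffunP => j; rewrite ffunE; case: eqP => [->|]. Qed.

(** The quotient identifies combinations that agree under every multilinear map, so it is enough to
    evaluate both sides at an arbitrary multilinear [g]. *)
Lemma pure_multilinear n : multilinear (@pure R M n).
Proof.
move=> v i a y z; rewrite -[RHS]/(padd (pscale _ _) _) pscale_pi padd_pi.
apply/presentedP => N g gP; rewrite /lincomb !big_cons !big_nil /= !addr0.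
by rewrite mulr1 !scale1r gP.
Qed.

Lemma multilinearZ n (N : lmodType R) (g : {ffun 'I_n -> M} -> N) :
  multilinear g -> forall v i a y, g (ffset v i (a *: y)) = a *: g (ffset v i y).
Proof.
move=> gP v i a y; have g0 : g (ffset v i 0) = 0.
  (* The coefficient -1 gives [g 0 = - g 0 + g 0], and the right side vanishes. *)
  by have := gP v i (-1) 0 0; rewrite scaler0 addr0 scaleN1r addNr.
by rewrite -[a *: y]addr0 gP g0 addr0.
Qed.

Lemma multilinear_scale n (N : lmodType R) (g : {ffun 'I_n -> M} -> N) :
  multilinear g -> forall (c : 'I_n -> R) (v : {ffun 'I_n -> M}),
  g [ffun i => c i *: v i] = (\prod_i c i) *: g v.
Proof.
move=> gP c v.
(* The scalars are pulled out one position at a time: [s] lists the positions scaled so far, without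
   repetition. *)
suff H (s : seq 'I_n) : uniq s ->
    g [ffun i => (if i \in s then c i else 1) *: v i] = (\prod_(i <- s) c i) *: g v.
  have := H _ (index_enum_uniq _); rewrite -/(index_enum _) => <-; congr g.
  by apply/ffunP => i; rewrite !ffunE mem_index_enum.
elim: s => [|i s IH] /=.
  by move=> _; rewrite big_nil scale1r; congr g; apply/ffunP => i; rewrite ffunE scale1r.
move=> /andP[si us]; rewrite big_cons -scalerA -IH//.
set w := [ffun i => _ *: v i] in IH *.
(* Position [i] is not in [s], so [w] carries the factor 1 there, and homogeneity in that position
   brings in [c i]. *)
rewrite -[w in RHS](ffset_id _ i) -multilinearZ//; congr g.
apply/ffunP => j; rewrite !ffunE inE; have [->|] //= := eqVneq j i.
by rewrite (negPf si) scale1r.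
Qed.

Lemma pureZ_const n (a : R) (x : M) :
  pure [ffun=> a *: x] = a ^+ n *: pure [ffun=> x] :> tpow M n.
Proof.
have -> : [ffun=> a *: x] = [ffun i : 'I_n => a *: ([ffun=> x] : {ffun 'I_n -> M}) i].
  by apply/ffunP => i; rewrite !ffunE.
rewrite (multilinear_scale (@pure_multilinear n) (fun=> a)).
by rewrite prodr_const card_ord.
Qed.

Lemma pext_tpow n (N : lmodType R) (g : {ffun 'I_n -> M} -> N) : multilinear g ->
  (forall v, pext id g (pure v) = g v) /\
  (forall a (t u : tpow M n), pext id g (a *: t + u) = a *: pext id g t + pext id g u).
Proof.
move=> gP; split=> [v|a t u].
  exact: (@pext_gen _ _ _ (@multilinear R M n) idfun N g gP).
exact: (@pext_linear _ _ _ (@multilinear R M n) idfun N g gP).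
Qed.

Lemma tpow_ind n (Q : tpow M n -> Prop) :
  Q 0 -> (forall a v t, Q t -> Q (a *: pure v + t)) -> forall t, Q t.
Proof. exact: presented_ind. Qed.

Section Rank1.
Context (x : M) (x_free : bijective (fun a : R => a *: x)) (n : nat).

Lemma pure_free1 (v : {ffun 'I_n -> M}) :
  pure v = (\prod_i free1_coord x_free (v i)) *: pure [ffun=> x].
Proof.
rewrite -(multilinear_scale (@pure_multilinear n)); congr pure.
by apply/ffunP => i; rewrite !ffunE -free1_coordK.
Qed.

(** The linear extension of this product takes the value 1 on the tensor power of [x]. It reads off
    coefficients, which gives the injectivity in [tpow_free1]. *)
Lemma prod_coord_multilinear :
  multilinear (fun v : {ffun 'I_n -> M} => \prod_i free1_coord x_free (v i) : R^o).
Proof.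
move=> v i a y z.
have E u : \prod_j free1_coord x_free (ffset v i u j) =
    free1_coord x_free u * \prod_(j | j != i) free1_coord x_free (v j).
  rewrite (bigD1 i)//= ffunE eqxx; congr (_ * _).
  by apply: eq_bigr => j /negPf ji; rewrite ffunE ji.
by rewrite !E free1_coord_linear mulrDl -mulrA.
Qed.

Lemma tpow_free1 : bijective (fun a : R => a *: (pure [ffun=> x] : tpow M n)).
Proof.
have [gE gL] := pext_tpow prod_coord_multilinear.
apply: bij_of_inj_surj => [a b|].
  move=> ab; have H c : pext id (fun v : {ffun 'I_n -> M} =>
      \prod_i free1_coord x_free (v i) : R^o) (c *: (pure [ffun=> x] : tpow M n)) = c.
    rewrite -[_ *: _]addr0 gL gE.
    have := gL (-1) 0 0; rewrite scaler0 addr0 scaleN1r addNr => ->.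
    rewrite addr0 big1 ?[_ *: _]mulr1// => i _.
    by rewrite ffunE -[X in free1_coord _ X]scale1r free1_coordE.
  by rewrite -(H a) -(H b) ab.
elim/tpow_ind => [|a v _ [b <-]]; first by exists 0; rewrite scale0r.
rewrite (pure_free1 v); exists (a * \prod_i free1_coord x_free (v i) + b).
by rewrite scalerDl scalerA.
Qed.

End Rank1.
End TensorTheory.

(** * Base change of free modules of rank one *)

Section BaseChangeTheory.
Context (R R' : comPzRingType) (phi : {rmorphism R -> R'}).
Context (M : lmodType R) (x : M) (x_free : bijective (fun a : R => a *: x)).

Lemma pgen_semilinear : semilinear_along phi (pgen (@semilinear_along _ _ phi M)).
Proof.
move=> a y z; rewrite -[RHS]/(padd (pscale _ _) _) pscale_pi padd_pi.
apply/presentedP => N g gP; rewrite /lincomb !big_cons !big_nil /= !addr0.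
by rewrite mulr1 !scale1r gP.
Qed.

Lemma semilinear0 (N : lmodType R') (g : M -> N) : semilinear_along phi g -> g 0 = 0.
Proof.
move=> gP; have := gP (-1) 0 0.
by rewrite scaler0 addr0 rmorphN rmorph1 scaleN1r addNr.
Qed.

Lemma semilinearZ (N : lmodType R') (g : M -> N) : semilinear_along phi g ->
  forall a y, g (a *: y) = phi a *: g y.
Proof. by move=> gP a y; rewrite -[a *: y]addr0 gP semilinear0// addr0. Qed.

Lemma base_change_mapE (N : lmodType R') (g : M -> N) : semilinear_along phi g ->
  (forall y, base_change_map phi g (pgen (@semilinear_along _ _ phi M) y) = g y) /\
  (forall a t u, base_change_map phi g (a *: t + u) =
     a *: base_change_map phi g t + base_change_map phi g u).
Proof.
move=> gP; split=> [v|a t u].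
  exact: (@pext_gen _ _ _ (@semilinear_along _ _ phi M) idfun N g gP).
exact: (@pext_linear _ _ _ (@semilinear_along _ _ phi M) idfun N g gP).
Qed.

(** The base change is spanned by the image of [x], and the induced map sends this generator to
    [g x], a basis of [N]. Coefficients are compared there. *)
Lemma base_change_map_bij (N : lmodType R') (g : M -> N) : semilinear_along phi g ->
  bijective (fun b : R' => b *: g x) -> bijective (base_change_map phi g).
Proof.
move=> gP gx_free; have [gE gL] := base_change_mapE gP.
have g0 : base_change_map phi g 0 = 0.
  by have := gL (-1) 0 0; rewrite scaler0 addr0 scaleN1r addNr.
have span (t : base_change phi M) :
    exists b : R', t = b *: pgen (@semilinear_along _ _ phi M) x.
  elim/presented_ind: t => [|b y _ [c ->]]; first by exists 0; rewrite scale0r.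
  rewrite [y](free1_coordK x_free) (semilinearZ pgen_semilinear) scalerA -scalerDl.
  by eexists.
apply: bij_of_inj_surj => [t u|n]; last first.
  have [b ->] := free1_span gx_free n.
  exists (b *: pgen (@semilinear_along _ _ phi M) x).
  by rewrite -[X in base_change_map _ _ X]addr0 gL gE g0 addr0.
have [b ->] := span t; have [c ->] := span u.
rewrite -[X in base_change_map _ _ X = _]addr0 -[X in _ = base_change_map _ _ X]addr0.
by rewrite !gL gE g0 !addr0 => /(free1_inj gx_free) ->.
Qed.

End BaseChangeTheory.

(** * Products of tensor powers and tensor powers of semilinear maps *)

Section TensorProduct.
Context (R : comPzRingType) (M : lmodType R).

Lemma ffcat_ffsetl m n (v : {ffun 'I_m -> M}) (w : {ffun 'I_n -> M}) i x :
  ffcat (ffset v i x) w = ffset (ffcat v w) (lshift n i) x.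
Proof.
apply/ffunP => k; rewrite !ffunE; case: split_ordP => j ->; rewrite ?ffunE.
  by rewrite (inj_eq (@lshift_inj _ _)).
by rewrite eq_rlshift.
Qed.

Lemma ffcat_ffsetr m n (v : {ffun 'I_m -> M}) (w : {ffun 'I_n -> M}) i x :
  ffcat v (ffset w i x) = ffset (ffcat v w) (rshift m i) x.
Proof.
apply/ffunP => k; rewrite !ffunE; case: split_ordP => j ->; rewrite ?ffunE.
  by rewrite eq_lrshift.
by rewrite (inj_eq (@rshift_inj _ _)).
Qed.

Lemma ffcat_const m n (x : M) :
  ffcat [ffun=> x] [ffun=> x] = [ffun=> x] :> {ffun 'I_(m + n) -> M}.
Proof. by apply/ffunP => k; rewrite !ffunE; case: split_ordP => j _; rewrite ffunE. Qed.

Section Tmul.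
Context (m n : nat).

Fact tmul_pure_multilinear (v : {ffun 'I_m -> M}) :
  multilinear (fun w : {ffun 'I_n -> M} => pure (ffcat v w)).
Proof. by move=> w i a x y; rewrite !ffcat_ffsetr pure_multilinear. Qed.

Fact tmul_multilinear (u : tpow M n) :
  multilinear (fun v : {ffun 'I_m -> M} => pext id (fun w => pure (ffcat v w)) u).
Proof.
(* All three extensions sum over the same representative of [u], so the identity is checked term by
   term. *)
move=> v i a x y; rewrite /pext scaler_sumr -big_split; apply: eq_bigr => p _.
rewrite /= !ffcat_ffsetl pure_multilinear scalerDr !scalerA.
by rewrite [p.1 * a]mulrC.
Qed.

Lemma tmul_linearl a (t t' : tpow M m) (u : tpow M n) :
  tmul (a *: t + t') u = a *: tmul t u + tmul t' u.
Proof. exact: (pext_tpow (tmul_multilinear u)).2. Qed.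

Lemma tmul_linearr a (t : tpow M m) (u u' : tpow M n) :
  tmul t (a *: u + u') = a *: tmul t u + tmul t u'.
Proof.
have E w : tmul t w =
    \sum_(p <- repr t) p.1 *: pext id (fun w => pure (ffcat p.2 w)) w by [].
rewrite !E scaler_sumr -big_split; apply: eq_bigr => p _ /=.
by rewrite (pext_tpow (tmul_pure_multilinear p.2)).2 scalerDr !scalerA [p.1 * a]mulrC.
Qed.

Lemma tmul_pure (v : {ffun 'I_m -> M}) (w : {ffun 'I_n -> M}) :
  tmul (pure v) (pure w) = pure (ffcat v w).
Proof.
rewrite /tmul (pext_tpow (tmul_multilinear _)).1.
by rewrite (pext_tpow (tmul_pure_multilinear v)).1.
Qed.

Lemma tmulZZ a b (t : tpow M m) (u : tpow M n) :
  tmul (a *: t) (b *: u) = (a * b) *: tmul t u.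
Proof.
have tmul0l (w : tpow M n) : tmul (0 : tpow M m) w = 0.
  by have := tmul_linearl (-1) 0 0 w; rewrite scaler0 addr0 scaleN1r addNr.
have tmul0r (w : tpow M m) : tmul w (0 : tpow M n) = 0.
  by have := tmul_linearr (-1) w 0 0; rewrite scaler0 addr0 scaleN1r addNr.
rewrite -[a *: t]addr0 -[b *: u]addr0 tmul_linearl tmul_linearr.
by rewrite tmul0l tmul0r !addr0 scalerA.
Qed.

End Tmul.

Lemma eq_tprod r n (F G : 'I_n -> tpow M r) : F =1 G -> tprod F = tprod G.
Proof. by move=> /funext ->. Qed.

(** Three families agreeing away from [i] replace updates of a single family: this form is stable
    under the shift along [lift ord0], as the induction on [n] requires. *)
Lemma tprod_multilinear r n (F G G' : 'I_n -> tpow M r) i a :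
  F i = a *: G i + G' i -> (forall j, j != i -> F j = G j /\ F j = G' j) ->
  tprod F = a *: tprod G + tprod G'.
Proof.
elim: n => [|n IH] in F G G' i *; first by case: i.
case: (unliftP ord0 i) => [j|] -> Fi FG /=.
  have [<- <-] := FG ord0 (neq_lift _ _).
  rewrite -tmul_linearr; congr tmul; apply: (IH _ _ _ j) => // k kj.
  by apply: FG; rewrite (inj_eq lift_inj).
have nl (k : 'I_n) : lift ord0 k != ord0 by rewrite eq_sym neq_lift.
have E : (fun i => F (lift ord0 i)) = (fun i => G (lift ord0 i)).
  by apply/funext => k; have [] := FG _ (nl k).
have E' : (fun i => F (lift ord0 i)) = (fun i => G' (lift ord0 i)).
  by apply/funext => k; have [] := FG _ (nl k).
by rewrite Fi tmul_linearl {1}E -E'.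
Qed.

Lemma tprod_pure_const r n (d : R) (x : M) :
  tprod (fun _ : 'I_n => d *: (pure [ffun=> x] : tpow M r)) =
  d ^+ n *: pure [ffun=> x].
Proof.
elim: n => [|n IH] /=.
  (* There is only one family indexed by ['I_0], so the filler 0 in [tprod] may be replaced by
     [x]. *)
  by rewrite scale1r; congr pure; apply/ffunP => -[].
by rewrite IH tmulZZ tmul_pure ffcat_const exprS.
Qed.

End TensorProduct.

Section TensorPowerMap.
Context (R R' : comPzRingType) (phi : {rmorphism R -> R'}).
Context (M : lmodType R) (M' : lmodType R') (r : nat) (eta : M -> tpow M' r).
Context (etaP : semilinear_along phi eta).

Fact tpow_map_multilinear n :
  @multilinear R M n (restr phi (tpow M' (n * r)))
    (fun v => tprod (fun i => eta (v i))).
Proof.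
move=> v i a x y; apply: (@tprod_multilinear _ _ _ _ _ _ _ i).
  by rewrite !ffunE eqxx etaP.
by move=> j /negPf ji; rewrite !ffunE ji.
Qed.

Lemma tpow_map_pure n (v : {ffun 'I_n -> M}) :
  tpow_map phi eta (pure v) = tprod (fun i => eta (v i)).
Proof.
exact: (@pext_gen _ _ _ (@multilinear R M n) phi _ _ (@tpow_map_multilinear n)).
Qed.

Lemma tpow_mapZ n a (t : tpow M n) :
  tpow_map phi eta (a *: t) = phi a *: tpow_map phi eta t.
Proof.
have L := @pext_linear _ _ _ (@multilinear R M n) phi _ _ (@tpow_map_multilinear n).
have L0 : tpow_map phi eta (0 : tpow M n) = 0.
  by have := L (-1) 0 0; rewrite scaler0 addr0 rmorphN rmorph1 scaleN1r addNr.
by rewrite -[a *: t]addr0 [LHS]L -/(tpow_map _ _ _) [X in _ + X]L0 addr0.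
Qed.

End TensorPowerMap.

(** * Discretely valued hyperfields *)

Section HyperfieldPowers.
Context (H : hyperfield).
Implicit Types x y z t : H.

Lemma hmulKr x y u : x [*] u = hone -> (y [*] u) [*] x = y.
Proof. by move=> xu; rewrite -hmulA (hmulC u) xu hmul1. Qed.

Lemma hmulACA x y z t : (x [*] y) [*] (z [*] t) = (x [*] z) [*] (y [*] t).
Proof. by rewrite -!hmulA; congr hmul; rewrite !hmulA (hmulC y). Qed.

Lemma hexpMn x y n : hexp (x [*] y) n = hexp x n [*] hexp y n.
Proof. by elim: n => [|n IH]; rewrite /= ?hmul1// IH hmulACA. Qed.

Lemma hexpD x m n : hexp x (m + n) = hexp x m [*] hexp x n.
Proof.
by elim: m => [|m IH]; rewrite /= ?(hmulC hone) ?hmul1// -/(hexp x (m + n)) IH hmulA.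
Qed.

Lemma hexpM x m n : hexp x (m * n) = hexp (hexp x n) m.
Proof. by elim: m => [//|m IH]; rewrite mulSn hexpD IH. Qed.

End HyperfieldPowers.

Section Values.
Context (K : realType) (H : valued_hyperfield K).
Implicit Types x y : H.

Lemma hinv_ex x : x <> hzero -> exists y, [/\ y <> hzero, x [*] y = hone &
  hnorm y = (hnorm x)^-1].
Proof.
move=> x0; have [y xy] := hmul_inv x0; exists y.
have nxy : hnorm x * hnorm y = 1 by rewrite -hnormM xy hnorm1.
have nx0 : hnorm x != 0 by rewrite gt_eqF// hnorm_gt0.
split=> //; last by apply: (mulfI nx0); rewrite nxy divff.
by move=> y0; move: nxy; rewrite y0 hnorm0 mulr0 => /esym/eqP; rewrite oner_eq0.
Qed.

Lemma hnormX x n : hnorm (hexp x n) = hnorm x ^+ n.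
Proof. by elim: n => [|n IH]; rewrite ?expr0 ?hnorm1// /= hnormM IH exprS. Qed.

(** Ultrametric isosceles principle for the triangle 0, [x], [y]: the side from [x] to [y] is
    shorter than the side from 0 to [x], so the other two sides are equal. *)
Lemma hdist_hnorm x y : hdist x y < hnorm x -> hnorm y = hnorm x.
Proof.
move=> xy; apply/eqP; rewrite eq_le; apply/andP; split.
  rewrite -(hdist0 y) (le_trans (hdist_tri _ x _))// ge_max hdist0 lexx/=.
  exact: ltW.
have := hdist_tri hzero y x; rewrite !hdist0 le_max => /orP[//|].
by rewrite hdistC leNgt xy.
Qed.

End Values.

Section DiscreteValuation.
Context (K : realType) (H : dv_hyperfield K).
Implicit Types x y e : H.

(** Otherwise the ball of radius [r] about 0 would contain no other value, and 0 would be an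
    isolated value. *)
Lemma exists_small_hnorm (r : K) : 0 < r -> exists2 x : H, x <> hzero & hnorm x < r.
Proof.
move=> r0; apply: contrapT => nex.
have r00 : range (@hnorm K H) 0 by exists hzero => //; rewrite hnorm0.
have [_ /(_ erefl)] := dv_discrete r00; apply; split; first exact/mem_set.
exists (ball (0 : K) r); first exact: nbhsx_ballx.
apply/seteqP; split=> v /= => [[]|->]; last by split=> //; exact: ballxx.
rewrite /ball/= sub0r normrN => vr [x _ xv]; rewrite -xv in vr *.
apply: contrapT => x0; apply: nex; exists x; first by move=> E; apply: x0; rewrite E hnorm0.
by rewrite ger0_norm ?hnorm_ge0// in vr.
Qed.

(** The nonzero value 1 is isolated. Applied to quotients, this bounds the ratios of distinct values
    away from 1. *)
Lemma hnorm_gap : exists2 d : K, 0 < d &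
  forall x : H, `|1 - hnorm x| < d -> hnorm x = 1.
Proof.
have r1 : range (@hnorm K H) 1 by exists hone => //; rewrite hnorm1.
have [h1 _] := dv_discrete r1.
have [_ [V /nbhs_ballP[d d0 dV] VE]] : isolated (range (@hnorm K H)) 1.
  by apply: contrapT => /h1/eqP; rewrite oner_eq0.
exists d => // x xd; have : (V `&` range (@hnorm K H)) (hnorm x).
  by split; [apply: dV|exists x].
by rewrite VE.
Qed.

Let S := [set hnorm x | x in [set x : H | x <> hzero /\ hnorm x < 1]].

Fact theta_has_sup : has_sup S.
Proof.
split; last by exists 1 => _ [x [_ /ltW ?] <-].
by have [x x0 x1] := exists_small_hnorm ltr01; exists (hnorm x); exists x.
Qed.

Lemma hnorm_le_theta x : hnorm x < 1 -> hnorm x <= theta H.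
Proof.
have [->|/eqP x0 x1] := eqVneq x hzero; first by rewrite hnorm0 theta_ge0.
by apply: (ub_le_sup theta_has_sup.2); exists x.
Qed.

Lemma theta_gt0 : 0 < theta H.
Proof.
have [x x0 x1] := exists_small_hnorm ltr01.
exact: lt_le_trans (hnorm_gt0 x0) (hnorm_le_theta x1).
Qed.

(** If the supremum were not attained, two distinct values close enough below it would have a
    quotient inside the gap around 1. *)
Lemma exists_uniformizer : exists p : H, uniformizer p.
Proof.
have [d d0 gap] := hnorm_gap; have t0 := theta_gt0.
(* The margin [d * theta H] ensures that [hnorm x / hnorm y] exceeds [1 - d] for every [y] of
   nonzero value at most [theta H]. *)
have [_ [x [x0 x1] <-] xd] := sup_adherent (mulr_gt0 d0 t0) theta_has_sup.
exists x; rewrite /uniformizer; apply/eqP; rewrite eq_le hnorm_le_theta//= leNgt.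
apply/negP => xt; have xt' : 0 < theta H - hnorm x by rewrite subr_gt0.
have [_ [y [y0 y1] <-]] := sup_adherent xt' theta_has_sup.
rewrite -/(theta H) opprB addrC subrK => xy.
have [u [u0 yu nu]] := hinv_ex y0.
have ny := hnorm_gt0 y0; have nx := hnorm_gt0 x0.
have xu1 : hnorm (x [*] u) < 1 by rewrite hnormM nu ltr_pdivrMr// mul1r.
suff : hnorm (x [*] u) = 1 by move=> E; rewrite E ltxx in xu1.
apply: gap; rewrite ger0_norm ?subr_ge0 ?ltW// ltrBlDr -ltrBlDl hnormM nu.
rewrite ltr_pdivlMr//; have yt := hnorm_le_theta y1.
(* For [d] at most 1, the bound [hnorm y <= theta H] may be multiplied by [1 - d]; for larger [d]
   the left side is not positive. *)
have [d1|/ltW d1] := leP d 1.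
  apply: (@le_lt_trans _ _ ((1 - d) * theta H)); first by rewrite ler_wpM2l ?subr_ge0.
  by rewrite mulrBl mul1r.
by apply: le_lt_trans nx; apply: mulr_le0_ge0; rewrite ?subr_le0 ?hnorm_ge0.
Qed.

(** A supremum equal to 1 would be approached by values below 1, against the gap there. *)
Lemma theta_lt1 : theta H < 1.
Proof.
have [p pt] := exists_uniformizer; rewrite -pt.
have [d d0 gap] := hnorm_gap; have t0 := theta_gt0.
rewrite lt_neqAle; apply/andP; split; last first.
  by rewrite pt; apply: (ge_sup theta_has_sup.1) => _ [x [_ /ltW ?] <-].
apply/eqP => p1; have := sup_adherent d0 theta_has_sup.
rewrite -/(theta H) -pt p1 => -[_ [x [x0 x1] <-] xd].
suff E : hnorm x = 1 by rewrite E ltxx in x1.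
by apply: gap; rewrite ger0_norm ?subr_ge0 ?ltW// ltrBlDr -ltrBlDl.
Qed.

Lemma uniformizer_neq0 (p : H) : uniformizer p -> p <> hzero.
Proof.
by move=> pt p0; have := theta_gt0; rewrite -pt p0 hnorm0 ltxx.
Qed.

Lemma theta_exp_small (r : K) : 0 < r -> exists n, theta H ^+ n < r.
Proof.
move=> r0; have := @cvg_expr K (theta H).
rewrite ger0_norm ?theta_ge0// => /(_ theta_lt1)/cvgr0Pnorm_lt/(_ r r0)[n _ /(_ n (leqnn n))] /=.
by rewrite ger0_norm ?exprn_ge0 ?theta_ge0// => h; exists n.
Qed.

(** Take the largest [n] with [hnorm x <= theta H ^+ n]. If the inequality were strict, the quotient
    of [x] by the [n]-th power of a uniformizer would have value below 1, hence at most [theta H],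
    and [n.+1] would also qualify. *)
Lemma hnorm_theta_exp x : x <> hzero -> hnorm x <= 1 ->
  exists n, hnorm x = theta H ^+ n.
Proof.
move=> x0 x1; have nx := hnorm_gt0 x0; have t0 := theta_gt0.
have [N Nx] := theta_exp_small nx.
have ex : exists n, hnorm x <= theta H ^+ n by exists 0%N.
have ub n : hnorm x <= theta H ^+ n -> (n <= N)%N.
  move=> xn; rewrite leqNgt; apply/negP => Nn.
  have tnN : theta H ^+ n < theta H ^+ N by rewrite ltr_iXn2l ?theta_lt1.
  by have := le_lt_trans xn (lt_trans tnN Nx); rewrite ltxx.
case: (ex_maxnP ex ub) => n xn nmax; exists n.
have [p pt] := exists_uniformizer.
have pn0 : hexp p n <> hzero.
  by move/hnorm_eq0/eqP; rewrite hnormX pt expf_eq0 (gt_eqF t0) andbF.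
have [u [u0 pu nu]] := hinv_ex pn0; rewrite hnormX pt in nu.
apply/eqP; rewrite eq_le xn/= leNgt; apply/negP => xn'.
have : hnorm (x [*] u) < 1 by rewrite hnormM nu ltr_pdivrMr ?exprn_gt0// mul1r.
move/hnorm_le_theta; rewrite hnormM nu ler_pdivrMr ?exprn_gt0// -exprS.
by move/nmax; rewrite ltnn.
Qed.

(** If 1 - 1 were reduced to 0, scaling would give [z - z = 0] for all [z]. The difference of two
    elements of [x + y] lies in [(x - x) + (y - y)], so every sum would be a singleton. *)
Lemma exists_sub_neq0 : exists2 e : H, (hone [-] hone) e & e <> hzero.
Proof.
apply: contrapT => nex; apply: (@dv_not_field K H) => x y.
have sub0 z e : (z [-] z) e -> e = hzero.
  have [->|/eqP z0] := eqVneq z hzero; first by move=> /hsubx0.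
  have [u [u0 zu _]] := hinv_ex z0.
  move=> /(hmulDE u); rewrite hmulN zu => eu.
  apply: contrapT => e0; apply: nex; exists (e [*] u) => //.
  by move=> eu0; apply: e0; rewrite -(hmul1 e) -zu (hmulC z) hmulA eu0 hmul0.
have [z xyz] := hadd_ne x y; exists z; apply/seteqP; split=> [w xyw|_ ->] //.
have [v wzv] := hadd_ne w (hopp z).
have [a [b [/sub0 -> /sub0 ->]]] := haddACA xyw (haddN xyz) wzv.
by rewrite hadd0 => v0; apply/hsub0; rewrite -v0.
Qed.

(** If the value of [e] were at least 1, absorption would turn 1 + (-1) into the singleton of 1,
    although it contains 0. *)
Lemma hsub1_hnorm_lt1 e : (hone [-] hone) e -> hnorm e < 1.
Proof.
move=> e11; rewrite ltNge; apply/negP => e1; apply: (@hone_neq0 H).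
by apply: (hadd_absorb e11 _ (haddxN (hone : H))); rewrite hnormN hnorm1.
Qed.

(* Discreteness makes [1 - 1] a ball [{|z| <= |e|}], and then [|e|] is itself a
   radius for which all sums are (closed) balls. *)
Lemma rho_attained : exists2 e : H, (hone [-] hone) e & hnorm e = rho H.
Proof.
have t0 := theta_gt0; have t1 := theta_lt1.
have ex : exists k, `[< exists2 e : H, (hone [-] hone) e & hnorm e = theta H ^+ k >].
  have [e e11 e0] := exists_sub_neq0.
  have [k ek] := hnorm_theta_exp e0 (ltW (hsub1_hnorm_lt1 e11)).
  by exists k; apply/asboolP; exists e.
(* As [theta H < 1], the least exponent gives the largest value taken on 1 - 1. *)
case: (ex_minnP ex) => k /asboolP[e e11 ek] kmin; exists e => //.
have emax (z : H) : (hone [-] hone) z -> hnorm z <= hnorm e.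
  move=> z11; have [->|/eqP z0] := eqVneq z hzero; first by rewrite hnorm0 hnorm_ge0.
  have [j zj] := hnorm_theta_exp z0 (ltW (hsub1_hnorm_lt1 z11)).
  rewrite zj ek ler_wiXn2l ?theta_ge0 ?(ltW t1)//; apply: kmin; apply/asboolP.
  by exists z.
apply/eqP; rewrite eq_le; apply/andP; split.
  by have := hsubxx_le e11; rewrite hnorm1 mulr1.
have e_gt0 : 0 < hnorm e by rewrite ek exprn_gt0.
apply: ge_inf; first by exists 0 => r [/ltW].
split=> //; left => x y.
have [r r0 rb] := hnorm_ball H.
have m_ge0 : 0 <= Num.max (hnorm x) (hnorm y) by rewrite le_max hnorm_ge0.
have [|m_le0] := ltP 0 (Num.max (hnorm x) (hnorm y)); last first.
  have n0 (w : H) : hnorm w <= 0 -> w = hzero.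
    by move=> w0; apply/hnorm_eq0/eqP; rewrite eq_le w0 hnorm_ge0.
  rewrite ge_max in m_le0; have /andP[/n0 -> /n0 ->] := m_le0; exists hzero.
  rewrite hnorm0 maxxx mulr0 hadd0; apply/seteqP; split=> z /=.
    by move=> ->; change (hdist (hzero : H) hzero <= 0); rewrite hdistxx.
  by move=> /hdist_eq0.
move=> m_gt0; have [m m0 mE] : exists2 m : H, m <> hzero &
    Num.max (hnorm x) (hnorm y) = hnorm m.
  case/orP: (le_total (hnorm x) (hnorm y)) => xy.
    by exists y; rewrite ?(max_idPr xy)//; move=> y0; move: m_gt0;
      rewrite (max_idPr xy) y0 hnorm0 ltxx.
  by exists x; rewrite ?(max_idPl xy)//; move=> x0; move: m_gt0;
    rewrite (max_idPl xy) x0 hnorm0 ltxx.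
have [u [u0 mu nu]] := hinv_ex m0; have nm := hnorm_gt0 m0.
(* [Q] is [<= r] or [< r], so that closed and open balls are treated together. A distance is the
   value of some [w]; after division by [m], both [Q] and the bound by [hnorm e] say that this value
   occurs on 1 - 1. *)
have ballE (Q : K -> Prop) (c z : H) : (forall a b, a <= b -> Q b -> Q a) ->
    (forall w : H, Q (hnorm w) <-> (hone [-] hone) w) ->
    Q (hdist c z / hnorm m) <-> hdist c z <= hnorm e * hnorm m.
  move=> Qle QE; have [w cw] : exists w : H, hdist c z = hnorm w.
    have [->|/eqP cz] := eqVneq c z; first by exists hzero; rewrite hdistxx hnorm0.
    by have [w czw] := hadd_ne c (hopp z); exists w; rewrite (hdistE cz czw).
  rewrite cw -ler_pdivrMr// -nu -hnormM; split=> [/QE/emax//|we].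
  by apply: Qle we _; apply/QE.
have h0 := haddxN (hone : H); rewrite mE.
case: rb => [cl|op].
  have QE (w : H) : hnorm w <= r <-> (hone [-] hone) w.
    have [c' E] := cl hone (hopp hone).
    rewrite hnormN maxxx hnorm1 mulr1 in E; rewrite E in h0 *.
    by rewrite -(hdist0 w) -(closed_hball_center _ h0).
  have [c E] := cl x y; exists c; rewrite E mE; apply/seteqP; split=> z;
    rewrite /closed_ball_of/= -/(hdist c z) -[_ <= r * _]ler_pdivrMr// => cz;
    by apply/(ballE (fun a => a <= r) c z) => // a b; exact: le_trans.
have QE (w : H) : hnorm w < r <-> (hone [-] hone) w.
  have [|c' E] := op hone (hopp hone); first by rewrite hnormN maxxx hnorm1.
  rewrite hnormN maxxx hnorm1 mulr1 in E; rewrite E in h0 *.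
  by rewrite -(hdist0 w) -(open_hball_center _ h0).
have [|c E] := op x y; first by rewrite mE.
exists c; rewrite E mE; apply/seteqP; split=> z;
  rewrite /closed_ball_of/open_ball_of/= -/(hdist c z) -[_ < r * _]ltr_pdivrMr// => cz;
  by apply/(ballE (fun a => a < r) c z) => // a b; exact: le_lt_trans.
Qed.

Lemma rho_gt0 : 0 < rho H.
Proof.
have [e e11 e0] := exists_sub_neq0.
apply: (lt_le_trans (hnorm_gt0 e0)).
by have := hsubxx_le e11; rewrite hnorm1 mulr1.
Qed.

Lemma rho_lt1 : rho H < 1.
Proof. by have [e e11 <-] := rho_attained; exact: hsub1_hnorm_lt1. Qed.

End DiscreteValuation.

(** * The triple of a hyperfield *)

Lemma ideal_inv (R : comPzRingType) (J : set R) (a : R) :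
  is_ideal J -> J a -> (exists b, b * a = 1) -> J = setT.
Proof.
move=> [_ _ JM] Ja [b ba]; apply/seteqP; split=> // c _.
by rewrite -[c]mulr1 -ba mulrA; exact: JM.
Qed.

Section TruncatedRing.
Context (K : realType) (H : dv_hyperfield K).
Local Notation R := (tr_ring H).

Lemma mpow_theta n (x : H) : (x \in mpow H n%:Z) = (hnorm x <= theta H ^+ n).
Proof. by rewrite mpowE. Qed.

Lemma mpow_0E (x : H) : (x \in mpow H 0) = (hnorm x <= 1).
Proof. by rewrite mpowE expr0z. Qed.

Lemma mpow_1E (x : H) : (x \in mpow H 1) = (hnorm x <= theta H).
Proof. by rewrite mpowE expr1z. Qed.

Lemma mpow_1_0 (x : H) : x \in mpow H 1 -> x \in mpow H 0.
Proof. by rewrite mpow_0E mpow_1E => /le_trans -> //; exact/ltW/theta_lt1. Qed.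

Lemma mclassZ i (x y : H) : x \in mpow H 0 -> y \in mpow H i ->
  (mclass 0 x : R) *: mclass i y = mclass i (x [*] y).
Proof. exact: mmulE. Qed.

Lemma mclassM (x y : H) : x \in mpow H 0 -> y \in mpow H 0 ->
  (mclass 0 x : R) * mclass 0 y = mclass 0 (x [*] y).
Proof. exact: mmulE. Qed.

Lemma hexp_in (x : H) n : x \in mpow H 0 -> hexp x n \in mpow H 0.
Proof. by rewrite !mpow_0E hnormX => x1; rewrite exprn_ile1 ?hnorm_ge0. Qed.

Lemma mclassX (x : H) n : x \in mpow H 0 ->
  (mclass 0 x : R) ^+ n = mclass 0 (hexp x n).
Proof.
by move=> xm; elim: n => [|n IH]; rewrite ?expr0// exprS IH mclassM ?hexp_in.
Qed.

Lemma hexp_uniformizer_in (p : H) n : uniformizer p -> hexp p n \in mpow H n%:Z.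
Proof. by move=> pt; rewrite mpow_theta hnormX pt. Qed.

Lemma uniformizer_in (p : H) : uniformizer p -> p \in mpow H 1.
Proof. by move=> pt; rewrite mpow_1E pt. Qed.

(** Multiplication by [x] scales distances by [theta H ^ i], which is the ratio of the radii
    defining M_i and M_0; hence injectivity. Surjectivity is division by [x]. *)
Lemma mclass_free1 i (x : H) : hnorm x = theta H ^ i ->
  bijective (fun a : R => a *: mclass i x).
Proof.
move=> xi; have x_in : x \in mpow H i by rewrite mpowE xi.
have ti : 0 < theta H ^ i by rewrite exprz_gt0// theta_gt0.
apply: bij_of_inj_surj => [a b|b].
  have [y ym ->] := mclassP a; have [z zm ->] := mclassP b.
  rewrite !mclassZ// => /(mclass_eq (mpow_mul ym x_in) (mpow_mul zm x_in)).
  rewrite hdistM xi ler_pM2r// => yz.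
  by apply/mclass_eq; rewrite // expr0z mulr1.
have [y ym ->] := mclassP b.
have x0 : x <> hzero by move=> x0; move: ti; rewrite -xi x0 hnorm0 ltxx.
have [u [u0 xu nu]] := hinv_ex x0.
exists (mclass 0 (y [*] u)); rewrite mclassZ ?hmulKr//.
by rewrite mpow_0E hnormM nu xi ler_pdivrMr// mul1r -mpowE.
Qed.

Lemma mclass0_inv (x : H) : hnorm x = 1 -> exists b : R, b * mclass 0 x = 1.
Proof.
move=> x1; have [b E] := free1_span (@mclass_free1 0 x x1) (mclass 0 hone).
by exists b; exact: esym E.
Qed.

(** The radius [rho * theta] is at most [rho], so the inclusion of balls passes to classes. This
    makes [teps] independent of the lift. *)
Lemma mclass_shift (x y : H) : x \in mpow H 1 -> y \in mpow H 1 ->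
  mclass 1 x = mclass 1 y -> mclass 0 x = mclass 0 y.
Proof.
move=> xm ym /(mclass_eq xm ym) xy; apply/mclass_eq; rewrite ?mpow_1_0//.
by apply: (le_trans xy); rewrite ler_wpM2l ?rho_ge0// expr1z expr0z ltW ?theta_lt1.
Qed.

Lemma teps_mclass (x : H) : x \in mpow H 1 -> @teps (Tr H) (mclass 1 x) = mclass 0 x.
Proof. by move=> xm; apply: mclass_shift; rewrite ?mlift_in ?mliftK. Qed.

Lemma teps_scalar : scalar (@teps (Tr H)).
Proof.
move=> a b c; have [x xm ->] := mclassP a; have [y ym ->] := mclassP b.
have [z zm ->] := mclassP c; have [t xyzt] := hadd_ne (x [*] y) z.
have xym := mpow_mul xm ym.
rewrite [X in teps (X + _)](mclassZ xm ym).
rewrite (mclassD xym zm xyzt) !teps_mclass ?(mpow_add xym zm xyzt)//.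
apply/esym; rewrite -[LHS]/((mclass 0 x : R) * mclass 0 y + mclass 0 z).
rewrite (mclassM xm (mpow_1_0 ym)).
exact: (mclassD (mpow_1_0 xym) (mpow_1_0 zm) xyzt).
Qed.

Lemma teps0r : @teps (Tr H) 0 = 0.
Proof.
by have := teps_scalar (-1) 0 0; rewrite scaler0 addr0 mulN1r addNr.
Qed.

Lemma tepsZ (a : R) b : @teps (Tr H) (a *: b) = a * @teps (Tr H) b.
Proof. by rewrite -[a *: b]addr0 teps_scalar teps0r addr0. Qed.

Let m : set R := range (@teps (Tr H)).

Lemma range_tepsP (a : R) : m a <-> exists2 x : H, x \in mpow H 1 & a = mclass 0 x.
Proof.
split=> [[b _ <-]|[x xm ->]]; first by exists (mlift b); rewrite ?mlift_in.
by exists (mclass 1 x); rewrite ?teps_mclass.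
Qed.

(** No value lies strictly between [theta H] and 1. *)
Lemma tr_ring_dichotomy (a : R) : m a \/ exists b : R, b * a = 1.
Proof.
have [x xm ->] := mclassP a; rewrite mpow_0E le_eqVlt in xm.
have [/eqP x1|x1] := orP xm; first by right; exact: mclass0_inv.
by left; apply/range_tepsP; exists x; rewrite // mpow_1E hnorm_le_theta.
Qed.

(** Since [rho H < 1], any lift of 1 has value 1, which exceeds [theta H]. *)
Lemma teps_neq1 : ~ m 1.
Proof.
move/range_tepsP => [x xm] /(mclass_eq (hone_in H) (mpow_1_0 xm)).
rewrite expr0z mulr1 => x1; have r1 := rho_lt1 H.
have : hnorm x = hnorm (hone : H) by apply: hdist_hnorm; rewrite hnorm1 (le_lt_trans x1).
by rewrite hnorm1 => E; move: xm; rewrite mpow_1E E leNgt theta_lt1.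
Qed.

Lemma range_teps_ideal : is_ideal m.
Proof.
split; first by exists 0; rewrite ?teps0r.
  move=> _ _ [a _ <-] [b _ <-]; exists (a + b) => //.
  by rewrite -[a]scale1r teps_scalar mul1r scale1r.
by move=> a _ [b _ <-]; exists (a *: b); rewrite ?tepsZ.
Qed.

Lemma ideal_sub_range_teps (J : set R) : is_ideal J -> J <> setT -> J `<=` m.
Proof.
by move=> Ji JT a Ja; have [//|/(ideal_inv Ji Ja)] := tr_ring_dichotomy a.
Qed.

Lemma range_teps_maximal : is_maximal_ideal m.
Proof.
split; first exact: range_teps_ideal.
  by move=> mT; apply: teps_neq1; rewrite mT.
move=> J Ji mJ; have [|JT] := pselect (J = setT); first by right.
by left; apply/seteqP; split=> //; exact: ideal_sub_range_teps.
Qed.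

Lemma maximal_ideal_unique (I : set R) : is_maximal_ideal I -> I = m.
Proof.
move=> [Ii IT Imax]; have [|//|] := Imax _ range_teps_ideal; last first.
  by move=> mT; case: teps_neq1; rewrite mT.
exact: ideal_sub_range_teps.
Qed.

Lemma tr_ring_local : is_local R.
Proof.
exists m; split=> [|I /maximal_ideal_unique ->//]; exact: range_teps_maximal.
Qed.

Lemma range_teps_principal : is_principal m.
Proof.
have [p pt] := exists_uniformizer H; have pm := uniformizer_in pt.
exists (mclass 0 p); rewrite -teps_mclass//.
apply/seteqP; split=> a [b _ <-]; last by exists (b *: mclass 1 p); rewrite ?tepsZ.
by have [c ->] := free1_span (@mclass_free1 1 p pt) b; exists c; rewrite ?tepsZ.
Qed.

Lemma uniformizer_nilpotent (p : H) : uniformizer p ->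
  exists k, mclass 0 (hexp p k) = 0 :> R.
Proof.
move=> pt; have [k kr] := theta_exp_small H (rho_gt0 H); exists k.
have p_in := hexp_in k (mpow_1_0 (uniformizer_in pt)).
apply/mclass_eq; rewrite ?mpow0// expr0z mulr1 hdistC hdist0 hnormX pt.
exact: ltW.
Qed.

(* Every ideal is generated by a power of the uniformizer, hence determined by
   the powers it contains. *)
Lemma ideal_powers (p : H) (I J : set R) : uniformizer p -> is_ideal I -> is_ideal J ->
  (forall k, I (mclass 0 (hexp p k)) -> J (mclass 0 (hexp p k))) -> I `<=` J.
Proof.
move=> pt [I0 _ IM] [J0 _ JM] IJ a; have [x xm ->] := mclassP a.
have [->//|/eqP x0] := eqVneq x hzero.
have [n xn] := hnorm_theta_exp x0 (etrans (esym (mpow_0E x)) xm).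
have p1 := mpow_1_0 (uniformizer_in pt); have pn := hexp_in n p1.
have pn0 : hexp p n <> hzero.
  by move=> E; apply: x0; apply/hnorm_eq0; rewrite xn -pt -hnormX E hnorm0.
have [u [u0 pu nu]] := hinv_ex pn0; have [v [v0 xv nv]] := hinv_ex x0.
(* Having the same value, [x] and the [n]-th power of [p] are multiples of each other by elements of
   value 1. *)
have xu : x [*] u \in mpow H 0.
  by rewrite mpow_0E hnormM nu hnormX pt xn divff// expf_neq0// gt_eqF ?theta_gt0.
have pv : hexp p n [*] v \in mpow H 0.
  by rewrite mpow_0E hnormM nv hnormX pt xn divff// expf_neq0// gt_eqF ?theta_gt0.
move=> Ix; have : I (mclass 0 (hexp p n)).
  by rewrite -[hexp p n](hmulKr _ xv) -mclassM//; exact: IM.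
by move=> /IJ Jp; rewrite -[x](hmulKr _ pu) -mclassM//; exact: JM.
Qed.

(** Powers of [p] beyond the [k]-th vanish in R, so an ideal is determined by which of finitely many
    powers it contains. Each such membership stabilises along the chain, and the maximum of these
    stages works. *)
Lemma tr_ring_artinian : is_artinian R.
Proof.
move=> I Ii Idec; have [p pt] := exists_uniformizer H.
have [k pk] := uniformizer_nilpotent pt.
have Ile l n : (l <= n)%N -> I n `<=` I l.
  move=> ln; rewrite -(subnK ln); elim: (n - l)%N => [//|d IH].
  by apply: subset_trans IH; exact: Idec.
have stab j : exists n, forall l, (n <= l)%N ->
    I n (mclass 0 (hexp p j)) -> I l (mclass 0 (hexp p j)).
  (* Either the power lies in every [I n], or it is absent from some [I n] and the implication is
     vacuous from that stage. *)
  have [h|/existsNP[n nI]] := pselect (forall n, I n (mclass 0 (hexp p j))).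
    by exists 0%N => l _ _.
  by exists n.
have [f fP] := choice stab.
exists (\max_(j < k.+1) f j) => l nl; apply/seteqP; split; first exact: Ile.
apply: (ideal_powers pt (Ii _) (Ii _)) => j Ij.
have [jk|kj] := leqP j k; last first.
  have -> : mclass 0 (hexp p j) = 0 :> R.
    have p1 := mpow_1_0 (uniformizer_in pt).
    by rewrite -mclassX// -(subnK (ltnW kj)) exprD !mclassX// pk mulr0.
  by have [] := Ii l.
have fn : (f j <= \max_(j < k.+1) f j)%N by exact: (leq_bigmax (Ordinal (jk : (j < k.+1)%N))).
by apply: (fP j l (leq_trans fn nl)); exact: Ile fn _ Ij.
Qed.

Lemma Tr_is_triple : is_triple (Tr H).
Proof.
split; last exact: range_teps_maximal.
- split; [exact: tr_ring_local|exact: tr_ring_artinian|].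
  by move=> I /maximal_ideal_unique ->; exact: range_teps_principal.
- have [p pt] := exists_uniformizer H.
  by exists (mclass 1 p); exact: mclass_free1.
- exact: teps_scalar.
Qed.

End TruncatedRing.

(** * Functoriality *)

Lemma hmor_hexp (K : realType) (H H' : valued_hyperfield K) (f : hmor H H')
    (x : H) n :
  f (hexp x n) = hexp (f x) n.
Proof.
elim: n => [|n IH] /=; first exact: hmor1 (hmorP f).
by rewrite (hmor_mul (hmorP f)) IH.
Qed.

(** * Identification of M_n with the n-th tensor power of M *)

Section TensorIdentification.
Context (K : realType) (H : dv_hyperfield K).
Local Notation R := (tr_ring H).

Lemma mclass_hexp_free (p : H) n : uniformizer p ->
  bijective (fun a : R => a *: mclass n%:Z (hexp p n)).
Proof. by move=> pt; apply: mclass_free1; rewrite hnormX pt. Qed.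

Lemma pure_uniformizer_free (p : H) n : uniformizer p ->
  bijective (fun a : R => a *: (pure [ffun=> mclass 1 p] : tpow (mquot H 1) n)).
Proof. by move=> pt; apply: tpow_free1; exact: mclass_free1. Qed.

Lemma mpow_uniformizer (p : H) n (x : H) : uniformizer p -> x \in mpow H n%:Z ->
  exists2 y, y \in mpow H 0 & x = y [*] hexp p n.
Proof.
move=> pt; rewrite mpow_theta => xn.
have pn0 : hexp p n <> hzero.
  by move/hnorm_eq0/eqP; rewrite hnormX pt expf_eq0 (gt_eqF (theta_gt0 H)) andbF.
have [u [u0 pu nu]] := hinv_ex pn0.
exists (x [*] u); last by rewrite hmulKr.
by rewrite mpow_0E hnormM nu hnormX pt ler_pdivrMr ?mul1r// exprn_gt0// theta_gt0.
Qed.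

(** The class of [hexp p n] is a basis of M_n, so the coefficient picked by [xget] exists and is
    unique. *)
Lemma tens_idZ (p : H) n (c : R) : uniformizer p ->
  tens_id p (c *: mclass n%:Z (hexp p n)) = c *: pure [ffun=> mclass 1 p].
Proof.
move=> pt; rewrite /tens_id; set A := [set _ | _].
have Ac : A (xget 0 A) by apply: xgetPex; exists c.
by rewrite -(free1_inj (mclass_hexp_free n pt) Ac).
Qed.

Lemma tens_id_mclass (p : H) n (y : H) : uniformizer p -> y \in mpow H 0 ->
  tens_id p (mclass n%:Z (y [*] hexp p n)) =
  (mclass 0 y : R) *: pure [ffun=> mclass 1 p].
Proof.
move=> pt ym; rewrite -tens_idZ//; congr tens_id.
by rewrite mclassZ// hexp_uniformizer_in.
Qed.

Lemma tens_id_linear (p : H) n : uniformizer p -> linear (@tens_id K H p n).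
Proof.
move=> pt a b c.
have [b' ->] := free1_span (mclass_hexp_free n pt) b.
have [c' ->] := free1_span (mclass_hexp_free n pt) c.
by rewrite scalerA -scalerDl !tens_idZ// scalerDl scalerA.
Qed.

Lemma tens_id_bij (p : H) n : uniformizer p -> bijective (@tens_id K H p n).
Proof.
move=> pt; apply: bij_of_inj_surj => [a b|t].
  have [a' ->] := free1_span (mclass_hexp_free n pt) a.
  have [b' ->] := free1_span (mclass_hexp_free n pt) b.
  by rewrite !tens_idZ// => /(free1_inj (pure_uniformizer_free n pt)) ->.
have [c ->] := free1_span (pure_uniformizer_free n pt) t.
by exists (c *: mclass n%:Z (hexp p n)); rewrite tens_idZ.
Qed.

Lemma tens_id_hexp (p : H) n : uniformizer p ->
  tens_id p (mclass n%:Z (hexp p n)) = pure [ffun=> mclass 1 p].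
Proof. by move=> pt; rewrite -[mclass _ _]scale1r tens_idZ// scale1r. Qed.

Lemma tens_id_scale (p : H) n (a : R) b : uniformizer p ->
  @tens_id K H p n (a *: b) = a *: tens_id p b.
Proof.
move=> pt; have [b' ->] := free1_span (mclass_hexp_free n pt) b.
by rewrite scalerA !tens_idZ// scalerA.
Qed.

(** If [q] is [u] times [p], both the class of the [n]-th power and the [n]-th tensor power change
    by the [n]-th power of the class of [u]. *)
Lemma tens_id_uniformizer (p q : H) n : uniformizer p -> uniformizer q ->
  @tens_id K H p n =1 @tens_id K H q n.
Proof.
move=> pt qt a; have [c ->] := free1_span (mclass_hexp_free n qt) a.
rewrite [RHS]tens_idZ//.
have [u um ->] := @mpow_uniformizer p 1 q pt (uniformizer_in qt).
rewrite [hexp p 1]hmul1 hexpMn -(mclassZ (hexp_in n um)) ?hexp_uniformizer_in//.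
rewrite -(mclassZ um) ?uniformizer_in// -mclassX// scalerA tens_idZ//.
by rewrite pureZ_const scalerA.
Qed.

End TensorIdentification.

Lemma teps0_pure (T : triple_data) n : scalar (@teps T) ->
  (forall v : {ffun 'I_n -> tmod T}, teps0 (pure v) = \prod_i teps (v i)) /\
  (forall a (t : tpow (tmod T) n), teps0 (a *: t) = a * teps0 t).
Proof.
move=> epsP.
have gP : multilinear (fun v : {ffun 'I_n -> tmod T} =>
    (\prod_(i < n) teps (v i) : (tring T)^o)).
  move=> v i a x y.
  have E u : \prod_j teps (ffset v i u j) =
      teps u * \prod_(j | j != i) teps (v j) :> tring T.
    rewrite (bigD1 i)//= ffunE eqxx; congr (_ * _).
    by apply: eq_bigr => j /negPf ji; rewrite ffunE ji.
  by rewrite !E epsP mulrDl -mulrA.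
have [gE gL] := pext_tpow gP; split=> [//|a t].
have g0 : teps0 (0 : tpow (tmod T) n) = 0.
  by have := gL (-1) 0 0; rewrite scaler0 addr0 scaleN1r addNr.
by rewrite -[a *: t]addr0 [LHS]gL -/(teps0 0) g0 addr0.
Qed.

(** * Maps induced by a morphism on the quotients *)

Section QuotientMap.
Context (K : realType) (H H' : dv_hyperfield K) (f : hmor H H').
Let fP := hmorP f.

Lemma hmor_hdist (x y : H) : hdist (f x) (f y) <= hdist x y.
Proof.
have [->|/eqP xy] := eqVneq x y; first by rewrite !hdistxx.
have [z xyz] := hadd_ne x (hopp y); rewrite (hdistE xy xyz) -(hmor_norm fP).
by apply: hdist_le; rewrite -(hmorN fP); exact: hmor_addE.
Qed.

(** [rho H] is a value on 1 - 1 in [H], and [f] maps 1 - 1 into 1 - 1 without changing values. *)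
Lemma hmor_rho_le : rho H <= rho H'.
Proof.
have [e e11 <-] := rho_attained H; rewrite -(hmor_norm fP).
have := hmor_addE fP e11; rewrite (hmorN fP) (hmor1 fP) => /hsubxx_le.
by rewrite hnorm1 mulr1.
Qed.

Lemma hmor_theta : exists r, theta H = theta H' ^+ r.
Proof.
have [p pt] := exists_uniformizer H.
have [||r rE] := @hnorm_theta_exp _ H' (f p); last by exists r; rewrite -rE hmor_norm.
  by move/(hmor_eq0 fP)/(uniformizer_neq0 pt).
by rewrite (hmor_norm fP) pt ltW ?theta_lt1.
Qed.

(** The quotient of logarithms is thus a natural number, and [Tr_deg] never falls back on its
    default. *)
Lemma Tr_deg_unique r : theta H = theta H' ^+ r ->
  r%:R = ln (theta H) / ln (theta H') /\ Tr_deg H H' = r.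
Proof.
move=> E; have ln0 : ln (theta H') < 0 by rewrite ln_lt0// theta_gt0 theta_lt1.
have rE : r%:R = ln (theta H) / ln (theta H').
  by rewrite E lnXn ?theta_gt0// -[ln _ *+ r]mulr_natl mulfK// lt_eqF.
split=> //; rewrite /Tr_deg; set A := [set _ | _].
have : A (xget 0%N A) by apply: xgetPex; exists r.
by rewrite /A /= -rE => /eqP; rewrite eqr_nat => /eqP.
Qed.

Lemma Tr_degP : theta H = theta H' ^+ Tr_deg H H'.
Proof. by have [r rE] := hmor_theta; rewrite (Tr_deg_unique rE).2. Qed.

(** Common form of both components of [Tr_map]: levels 0 and 0 give the ring map, levels 1 and
    [Tr_deg H H'] give the module map before the identification with tensors. *)
Definition mquot_map (i j : int) (a : mquot H i) : mquot H' j :=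
  mclass j (f (mlift a)).

Section Level.
Context (i j : int) (ij : theta H ^ i = theta H' ^ j).

Lemma hmor_mpow (x : H) : x \in mpow H i -> f x \in mpow H' j.
Proof. by rewrite !mpowE (hmor_norm fP) ij. Qed.

(** The choice of lift is immaterial: [f] does not increase distances, and the radius in the target
    is at least the one in the source. *)
Lemma mquot_mapE (x : H) : x \in mpow H i -> mquot_map j (mclass i x) = mclass j (f x).
Proof.
move=> xm; have lm : mlift (mclass i x) \in mpow H i := mlift_in _.
have /(mclass_eq lm xm) lx : mclass i (mlift (mclass i x)) = mclass i x := mliftK _.
apply/mclass_eq; rewrite ?hmor_mpow//.
apply: le_trans (hmor_hdist _ _) (le_trans lx _).
by rewrite ij ler_wpM2r ?hmor_rho_le// theta_exp_ge0.
Qed.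

Lemma mquot_mapD (a b : mquot H i) : mquot_map j (a + b) = mquot_map j a + mquot_map j b.
Proof.
have [x xm ->] := mclassP a; have [y ym ->] := mclassP b.
have [z xyz] := hadd_ne x y.
rewrite (mclassD xm ym xyz) !mquot_mapE ?(mpow_add xm ym xyz)//.
apply/esym/mclassD; rewrite ?hmor_mpow//; exact: hmor_addE.
Qed.

End Level.

Definition tr_phi : tr_ring H -> tr_ring H' := @mquot_map 0 0.

Lemma theta_exp00 : theta H ^ 0 = theta H' ^ 0. Proof. by rewrite !expr0z. Qed.

Lemma mquot_mapZ i j (a : tr_ring H) (b : mquot H i) : theta H ^ i = theta H' ^ j ->
  mquot_map j (a *: b) = tr_phi a *: mquot_map j b.
Proof.
move=> ij; have [x xm ->] := mclassP a; have [y ym ->] := mclassP b.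
rewrite /tr_phi (mquot_mapE theta_exp00)// mclassZ// !(mquot_mapE ij) ?mpow_mul//.
by rewrite mclassZ ?(hmor_mpow theta_exp00)// ?(hmor_mpow ij)// (hmor_mul fP).
Qed.

Fact tr_phi_additive : GRing.zmod_morphism tr_phi.
Proof.
move=> a b; apply/eqP; rewrite eq_sym subr_eq -(mquot_mapD theta_exp00).
by rewrite subrK.
Qed.

Fact tr_phi_multiplicative : GRing.monoid_morphism tr_phi.
Proof.
split; last by move=> a b; exact: (@mquot_mapZ 0 0 a b theta_exp00).
by rewrite /tr_phi (mquot_mapE theta_exp00) ?hone_in// (hmor1 fP).
Qed.

HB.instance Definition _ := GRing.isZmodMorphism.Build _ _ tr_phi tr_phi_additive.
HB.instance Definition _ :=
  GRing.isMonoidMorphism.Build _ _ tr_phi tr_phi_multiplicative.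

Local Notation r := (Tr_deg H H').

Lemma theta_exp1r : theta H ^ 1 = theta H' ^ r%:Z.
Proof. by rewrite expr1z Tr_degP. Qed.

Lemma tr_eta_mclass (p' : H') (x : H) : uniformizer p' -> x \in mpow H 1 ->
  teta (Tr_map f) (mclass 1 x) = tens_id p' (mclass r%:Z (f x)).
Proof.
move=> pt' xm; rewrite -(mquot_mapE theta_exp1r xm).
apply: tens_id_uniformizer => //.
by apply: xgetPex; exact: exists_uniformizer.
Qed.

Lemma xget_uniformizer : uniformizer (xget hone (@uniformizer K H')).
Proof. by apply: xgetPex; exact: exists_uniformizer. Qed.

Lemma tr_eta_semilinear : semilinear_along tr_phi (teta (Tr_map f)).
Proof.
move=> a x y; rewrite -(tens_id_linear xget_uniformizer).
by rewrite -(mquot_mapZ _ _ theta_exp1r) -(mquot_mapD theta_exp1r).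
Qed.

(** Writing [f x] as [y] times the [r]-th power of [p'], both sides become the class of this product
    in the target ring. *)
Lemma tr_map_eps (a : mquot H 1) :
  tphi (Tr_map f) (@teps (Tr H) a) = teps0 (teta (Tr_map f) a).
Proof.
have [x xm ->] := mclassP a; rewrite teps_mclass//.
have [p' pt'] := exists_uniformizer H'; rewrite (tr_eta_mclass pt')//.
have fxm := hmor_mpow theta_exp1r xm.
have [y ym fxE] := mpow_uniformizer pt' fxm.
have [epsE epsZ] := teps0_pure r (@teps_scalar K H').
rewrite fxE tens_id_mclass// epsZ epsE.
rewrite (eq_bigr (fun=> mclass 0 p' : tr_ring H')); last first.
  by move=> i _; rewrite ffunE teps_mclass ?uniformizer_in.
have p1 := mpow_1_0 (uniformizer_in pt').
rewrite prodr_const card_ord mclassX// mclassM ?hexp_in// -fxE.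
by rewrite -(mquot_mapE theta_exp00)// mpow_1_0.
Qed.

Lemma Tr_map_is_tmor : is_tmor (Tr_map f).
Proof.
split; [exact: tr_phi_additive|exact: tr_phi_multiplicative|
  exact: tr_eta_semilinear|exact: tr_map_eps|].
have [p pt] := exists_uniformizer H; have [p' pt'] := exists_uniformizer H'.
apply: (@base_change_map_bij _ _ tr_phi _ (mclass 1 p)); first exact: mclass_free1.
  exact: tr_eta_semilinear.
(* With this value, the class of [f p] is a basis in degree [r], as [base_change_map_bij] requires
   after transport by [tens_id]. *)
have fpt : hnorm (f p) = theta H' ^ r%:Z by rewrite (hmor_norm fP) pt Tr_degP.
apply: (@eq_bij _ _ _ (bij_comp (tens_id_bij r pt') (mclass_free1 fpt))) => b.
rewrite [in RHS](tr_eta_mclass pt' (uniformizer_in pt)).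
exact: (tens_id_scale b _ pt').
Qed.

End QuotientMap.

Section Functoriality.
Context (K : realType).

(** The type of [teta] depends on the degree, so an equality of degrees can be rewritten only once
    the degree is a parameter. *)
Definition Tr_map_at (H H' : dv_hyperfield K) (f : hmor H H') (n : nat) :
    tmor_data (Tr H) (Tr H') :=
  @TMorData (Tr H) (Tr H') n (tr_phi f)
    (fun a => tens_id (xget hone (@uniformizer K H')) (mquot_map f n%:Z a)).

Lemma Tr_map_id (H : dv_hyperfield K) : Tr_map (hmor_id H) = tmor_id (Tr H).
Proof.
have [_ degE] := @Tr_deg_unique K H H 1 (esym (expr1 _)).
rewrite -[Tr_map _]/(Tr_map_at (hmor_id H) (Tr_deg H H)) degE /tmor_id.
congr TMorData; apply/funext => a; first exact: mliftK.
have pt := xget_uniformizer H; set p := xget _ _ in pt *.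
rewrite /mquot_map mliftK.
have [c ->] := free1_span (@mclass_free1 K H 1 p pt) a.
have E := tens_idZ 1 c pt; rewrite [hexp p 1]hmul1 in E.
by rewrite [LHS]E [RHS]pureZ_const.
Qed.

Lemma Tr_map_comp (H H' H'' : dv_hyperfield K) (f : hmor H H') (f' : hmor H' H'') :
  Tr_map (hmor_comp f' f) = tmor_comp (Tr_map f') (Tr_map f).
Proof.
have degE : Tr_deg H H'' = (Tr_deg H H' * Tr_deg H' H'')%N.
  apply: (Tr_deg_unique _).2.
  by rewrite mulnC exprM -(Tr_degP f') -(Tr_degP f).
rewrite -[Tr_map (hmor_comp _ _)]/(Tr_map_at (hmor_comp f' f) (Tr_deg H H'')).
rewrite degE /tmor_comp; congr TMorData; apply/funext => a; have [x xm ->] := mclassP a.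
  have fxm := hmor_mpow f (theta_exp00 _ _) xm; rewrite [LHS](mquot_mapE _ (theta_exp00 _ _))//.
  by rewrite -(mquot_mapE f' (theta_exp00 _ _))// -(mquot_mapE f (theta_exp00 _ _)).
have pt' := xget_uniformizer H'; have pt'' := xget_uniformizer H''.
set p' := xget _ _ in pt'; set p'' := xget _ _ in pt''.
have fxm := hmor_mpow f (theta_exp1r f) xm.
have [y ym fxE] := mpow_uniformizer pt' fxm.
have f'pm := hmor_mpow f' (theta_exp1r f') (uniformizer_in pt').
have [z zm f'pE] := mpow_uniformizer pt'' f'pm.
have tE : theta H ^ 1 = theta H'' ^ (Tr_deg H H' * Tr_deg H' H'')%N%:Z.
  by rewrite expr1z -degE; exact: Tr_degP (hmor_comp f' f).
(* With [r] the degree of [Tr_map f], substituting [f'pE] into the image of [fxE] under [f'] gives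
   the coefficient [f' y] times the [r]-th power of [z], in front of a power of [p'']. *)
transitivity ((mclass 0 (f' y [*] hexp z (Tr_deg H H')) : tr_ring H'') *:
    (pure [ffun=> mclass 1 p''] : tpow _ (Tr_deg H H' * Tr_deg H' H''))).
  rewrite (mquot_mapE (hmor_comp f' f) tE)// -(tens_id_mclass _ pt''); last first.
    by rewrite mpow_mul ?hexp_in// (hmor_mpow f' (theta_exp00 _ _)).
  congr (tens_id _ (mclass _ _)).
  rewrite /= fxE (hmor_mul (hmorP f')) hmor_hexp f'pE hexpMn -hexpM.
  by rewrite hmulA.
(* On the other side, the semilinear tensor power turns the tensor power of [p'] into a product of
   equal factors, each with coefficient the class of [z]. *)
rewrite /comp [X in tpow_map _ _ X](tr_eta_mclass f pt' xm) fxE tens_id_mclass//.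
rewrite [RHS](tpow_mapZ (phi := tr_phi f') (tr_eta_semilinear f')).
rewrite (tpow_map_pure (phi := tr_phi f') (tr_eta_semilinear f')).
rewrite (@eq_tprod _ _ _ _ _ (fun=> (mclass 0 z : tr_ring H'') *: pure [ffun=> mclass 1 p'']));
  last first.
  by move=> i; rewrite ffunE (tr_eta_mclass f' pt'' (uniformizer_in pt')) f'pE tens_id_mclass.
rewrite tprod_pure_const scalerA mclassX//; congr (_ *: _).
have f'ym := hmor_mpow f' (theta_exp00 _ _) ym.
rewrite -mclassM ?hexp_in//; congr (_ * _).
exact: esym (mquot_mapE f' (theta_exp00 _ _) ym).
Qed.

End Functoriality.

Theorem theorem5p8 (K : realType) :
  (* Tr sends objects to triples *)
  (forall H : dv_hyperfield K, is_triple (Tr H)) /\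
  (* every uniformizer identifies M_n with the n-th tensor power of M *)
  (forall (H : dv_hyperfield K) (p : H) (n : nat), uniformizer p ->
    [/\ linear (@tens_id K H p n), bijective (@tens_id K H p n) &
        tens_id p (mclass n%:Z (hexp p n)) = pure [ffun=> mclass 1 p]]) /\
  (* Tr(f) is the morphism of triples given on classes by f *)
  (forall (H H' : dv_hyperfield K) (f : hmor H H'),
    [/\ is_tmor (Tr_map f),
        (tdeg (Tr_map f))%:R = ln (theta H) / ln (theta H'),
        (forall x : H, x \in mpow H 0 ->
          tphi (Tr_map f) (mclass 0 x) = mclass 0 (f x)) &
        (forall (x : H) (p' : H'), x \in mpow H 1 -> uniformizer p' ->
          f x \in mpow H' (tdeg (Tr_map f))%:Z /\
          teta (Tr_map f) (mclass 1 x) =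
            tens_id p' (mclass (tdeg (Tr_map f))%:Z (f x)))]) /\
  (* Tr preserves identities and composition *)
  (forall H : dv_hyperfield K, Tr_map (hmor_id H) = tmor_id (Tr H)) /\
  (forall (H H' H'' : dv_hyperfield K) (f : hmor H H') (f' : hmor H' H''),
    Tr_map (hmor_comp f' f) = tmor_comp (Tr_map f') (Tr_map f)).
Proof.
split; first exact: Tr_is_triple.
split=> [H p n pt|].
  by split; [exact: tens_id_linear|exact: tens_id_bij|exact: tens_id_hexp].
split=> [H H' f|]; last by split; [exact: Tr_map_id|exact: Tr_map_comp].
split.
- exact: Tr_map_is_tmor.
- exact: (Tr_deg_unique (Tr_degP f)).1.
- by move=> x xm; exact: (mquot_mapE f (theta_exp00 _ _) xm).
- move=> x p' xm pt'; split; first exact: (hmor_mpow f (theta_exp1r f) xm).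
  exact: tr_eta_mclass.
Qed.
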